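(* Let $\Lambda=\{(V_i,\Lambda_i,v_i)\}_{i\in I}$ and $\Gamma=\{(W_j,\Gamma_j,w_j)\}_{j\in J}$ be g-fusion frames for $H$ and $K$ with g-fusion frame operators $S_\Lambda$ and $S_\Gamma$, respectively, and let $S_{\Lambda\otimes\Gamma}$ be the g-fusion frame operator of $\Lambda\otimes\Gamma=\{(V_i\otimes W_j,\Lambda_i\otimes\Gamma_j,v_iw_j)\}_{i,j}$. Then $\Theta=\{(S_{\Lambda\otimes\Gamma}^{-1}(V_i\otimes W_j),\ (\Lambda_i\otimes\Gamma_j)P_{V_i\otimes W_j}S_{\Lambda\otimes\Gamma}^{-1},\ v_iw_j)\}_{i,j}$ is a g-fusion frame for $H\otimes K$ (with respect to $\{H_i\otimes K_j\}_{i,j}$).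
   Context: $H,K$ separable Hilbert spaces, $I,J\subseteq\mathbb{Z}$, $\{H_i\}$, $\{K_j\}$ Hilbert spaces, $V_i\subseteq H$, $W_j\subseteq K$ closed subspaces, $\Lambda_i\in\mathcal{B}(H,H_i)$, $\Gamma_j\in\mathcal{B}(K,K_j)$, $v_i,w_j>0$. $P_V$ is the orthogonal projection onto $V$. $H\otimes K$ is the Hilbert tensor product ($\langle f\otimes g,f'\otimes g'\rangle=\langle f,f'\rangle\langle g,g'\rangle$, $\|f\otimes g\|=\|f\|\|g\|$); $Q\otimes T$ denotes the bounded operator with $(Q\otimes T)(f\otimes g)=Qf\otimes Tg$; $V\otimes W$ is the closed subspace of $H\otimes K$ generated by $V$ and $W$, with $P_{V\otimes W}=P_V\otimes P_W$. A family $\{(V_i,\Lambda_i,v_i)\}$ is a g-fusion frame for $H$ if $A\|f\|^2\le\sum_iv_i^2\|\Lambda_iP_{V_i}f\|^2\le B\|f\|^2$ for all $f\in H$, some $0<A\le B<\infty$; its frame operator is $S_\Lambda f=\sum_iv_i^2P_{V_i}\Lambda_i^*\Lambda_iP_{V_i}f$, which is positive and invertible. A family $\{(U_{ij},\Delta_{ij},u_{ij})\}_{i,j}$ with $U_{ij}\subseteq H\otimes K$ closed, $\Delta_{ij}\in\mathcal{B}(H\otimes K,H_i\otimes K_j)$, $u_{ij}>0$ is a g-fusion frame for $H\otimes K$ if there exist $0<A\le B<\infty$ with $A\|f\otimes g\|^2\le\sum_{i,j}u_{ij}^2\|\Delta_{ij}P_{U_{ij}}(f\otimes g)\|^2\le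 B\|f\otimes g\|^2$ for all $f\in H$, $g\in K$. The frame operator of $\Lambda\otimes\Gamma$ is $S_{\Lambda\otimes\Gamma}(f\otimes g)=\sum_{i,j}v_i^2w_j^2P_{V_i\otimes W_j}(\Lambda_i\otimes\Gamma_j)^*(\Lambda_i\otimes\Gamma_j)P_{V_i\otimes W_j}(f\otimes g)$. *)

(* Defs.v *)
From mathcomp Require Import all_boot all_order all_algebra.
From mathcomp Require Import all_classical reals ereal esum.
From mathcomp Require Import complex.
From Stdlib Require Import ClassicalEpsilon.

Set Implicit Arguments.
Unset Strict Implicit.
Unset Printing Implicit Defensive.

Import Order.TTheory GRing.Theory Num.Theory.
Local Open Scope ring_scope.
Local Open Scope complex_scope.
Local Open Scope classical_set_scope.

Record hilbert (R : realType) := Hilbert {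
  hsort :> lmodType R[i];
  hdot : hsort -> hsort -> R[i];
  hdot_linl : forall (a : R[i]) (x y z : hsort),
      hdot (a *: x + y) z = a * hdot x z + hdot y z;
  hdot_sym : forall x y : hsort, hdot y x = conjc (hdot x y);
  hdot_pos : forall x : hsort, 0 <= hdot x x;
  hdot_def : forall x : hsort, hdot x x = 0 -> x = 0;
  hcomplete : forall u : nat -> hsort,
      (forall e : R, 0 < e -> exists N : nat, forall m n : nat, (N <= m)%N -> (N <= n)%N ->
          Num.sqrt (complex.Re (hdot (u m - u n) (u m - u n))) < e) ->
      exists x : hsort, forall e : R, 0 < e -> exists N : nat, forall n : nat, (N <= n)%N ->
          Num.sqrt (complex.Re (hdot (u n - x) (u n - x))) < e
}.

Section Hilbert.
Variable R : realType.

Definition hnorm (X : hilbert R) (x : X) : R := Num.sqrt (complex.Re (hdot x x)).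

Definition hconv (X : hilbert R) (u : nat -> X) (x : X) : Prop :=
  forall e : R, 0 < e -> exists N : nat, forall n : nat, (N <= n)%N -> hnorm (u n - x) < e.

Definition separable (X : hilbert R) : Prop :=
  exists u : nat -> X, forall (x : X) (e : R), 0 < e -> exists n : nat, hnorm (x - u n) < e.

Definition lin_op (X Y : hilbert R) (A : X -> Y) : Prop :=
  forall (a : R[i]) (x y : X), A (a *: x + y) = a *: A x + A y.

Definition bounded_op (X Y : hilbert R) (A : X -> Y) : Prop :=
  lin_op A /\ exists M : R, forall x : X, hnorm (A x) <= M * hnorm x.

Definition closed_subspace (X : hilbert R) (V : set X) : Prop :=
  V 0 /\ (forall (a : R[i]) (x y : X), V x -> V y -> V (a *: x + y)) /\
  (forall (u : nat -> X) (x : X), (forall n, V (u n)) -> hconv u x -> V x).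

Definition hproj (X : hilbert R) (V : set X) : X -> X := fun x =>
  epsilon (inhabits (0 : X)) (fun p => V p /\ forall y, V y -> hdot (x - p) y = 0).

Definition hadj (X Y : hilbert R) (A : X -> Y) : Y -> X := fun y =>
  epsilon (inhabits (0 : X)) (fun x => forall z : X, hdot (A z) y = hdot z x).

Definition opinv (X : hilbert R) (A : X -> X) : X -> X :=
  epsilon (inhabits (fun x : X => x)) (fun B => cancel A B /\ cancel B A).

(* unconditional (net over finite subsets) convergence of sum_{i in I} F i to s *)
Definition has_usum (T : eqType) (X : hilbert R) (I : set T) (F : T -> X) (s : X) : Prop :=
  forall e : R, 0 < e -> exists s0 : seq T, (forall i, i \in s0 -> I i) /\
    forall s1 : seq T, uniq s1 -> {subset s0 <= s1} -> (forall i, i \in s1 -> I i) ->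
      hnorm (\sum_(i <- s1) F i - s) < e.

Definition usum (T : eqType) (X : hilbert R) (I : set T) (F : T -> X) : X :=
  epsilon (inhabits (0 : X)) (has_usum I F).

(* Hilbert tensor product: t : X -> Y -> Z is bilinear, <f(x)g, f'(x)g'> = <f,f'><g,g'>
   and the span of the elementary tensors is dense in Z.  This characterizes
   Z = X (x) Y up to unitary isomorphism. *)
Definition is_tensor (X Y Z : hilbert R) (t : X -> Y -> Z) : Prop :=
  (forall f : X, lin_op (t f)) /\ (forall g : Y, lin_op (fun f => t f g)) /\
  (forall (f f' : X) (g g' : Y), hdot (t f g) (t f' g') = hdot f f' * hdot g g') /\
  (forall (z : Z) (e : R), 0 < e -> exists s : seq (X * Y),
      hnorm (z - \sum_(p <- s) t p.1 p.2) < e).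

Definition tensop (X Y Z X' Y' Z' : hilbert R) (t : X -> Y -> Z) (t' : X' -> Y' -> Z')
    (Q : X -> X') (T : Y -> Y') : Z -> Z' :=
  epsilon (inhabits (fun _ : Z => (0 : Z')))
    (fun A => bounded_op A /\ forall f g, A (t f g) = t' (Q f) (T g)).

Definition tens_sub (X Y Z : hilbert R) (t : X -> Y -> Z) (V : set X) (W : set Y) : set Z :=
  fun z => forall U : set Z, closed_subspace U ->
    (forall f g, V f -> W g -> U (t f g)) -> U z.

Definition gfusion_frame (X : hilbert R) (Y : int -> hilbert R) (I : set int)
    (V : int -> set X) (L : forall i, X -> Y i) (v : int -> R) : Prop :=
  (forall i, I i -> [/\ closed_subspace (V i), bounded_op (L i) & 0 < v i]) /\
  exists A B : R, [/\ 0 < A, A <= B &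
    forall f : X,
      ((A * hnorm f ^+ 2)%:E <=
         \esum_(i in I) ((v i ^+ 2 * hnorm (L i (hproj (V i) f)) ^+ 2)%:E) <=
       (B * hnorm f ^+ 2)%:E)%E].

(* g-fusion frame {(U_ij, D_ij, u_ij)}_{i in I, j in J} for the tensor product
   Z = X (x) Y (tensor map t) w.r.t. the spaces Y_ij; the frame inequality is
   required on elementary tensors f (x) g, as in the paper's definition. *)
Definition gfusion_frame_tens (X Y Z : hilbert R) (t : X -> Y -> Z)
    (Yij : int -> int -> hilbert R) (I J : set int)
    (U : int -> int -> set Z) (D : forall i j, Z -> Yij i j) (u : int -> int -> R) : Prop :=
  (forall i j, I i -> J j -> [/\ closed_subspace (U i j), bounded_op (D i j) & 0 < u i j]) /\
  exists A B : R, [/\ 0 < A, A <= B &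
    forall (f : X) (g : Y),
      ((A * hnorm (t f g) ^+ 2)%:E <=
         \esum_(p in I `*` J)
            ((u p.1 p.2 ^+ 2 * hnorm (D p.1 p.2 (hproj (U p.1 p.2) (t f g))) ^+ 2)%:E) <=
       (B * hnorm (t f g) ^+ 2)%:E)%E].

Definition frame_op_tens (X Y Z : hilbert R) (t : X -> Y -> Z)
    (Xi Yj : int -> hilbert R) (Zij : int -> int -> hilbert R)
    (tij : forall i j, Xi i -> Yj j -> Zij i j) (I J : set int)
    (V : int -> set X) (W : int -> set Y)
    (L : forall i, X -> Xi i) (G : forall j, Y -> Yj j) (v w : int -> R) : Z -> Z :=
  fun z => usum (I `*` J) (fun p : int * int =>
    let i := p.1 in let j := p.2 in
    let P := hproj (tens_sub t (V i) (W j)) in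
    let LG := tensop t (tij i j) (L i) (G j) in
    ((v i * w j) ^+ 2)%:C *: P (hadj LG (LG (P z)))).

End Hilbert.

(* Main.v *)
(* A family of bounded operators Q_p with a|z|^2 <= sum_p |Q_p z|^2 <= b|z|^2
   has a frame operator S = sum_p Q_p^* Q_p, which converges unconditionally, is
   self-adjoint and is bounded below, hence is a bijection with bounded inverse.
   For Q_ij = v_i w_j (L_i (x) G_j) P_(V_i (x) W_j) the orthogonal complement of
   S^-1 (V_i (x) W_j) is mapped by S^-1 into the complement of V_i (x) W_j, so the
   sum for the dual family at z is sum_ij |Q_ij (S^-1 z)|^2, which is comparable
   to |S^-1 z|^2 and therefore to |z|^2.

   S is an operator on the whole of H (x) K, so the frame inequality for the Q_ij
   is needed there and not only on elementary tensors. On a finite sum of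
   elementary tensors one factor is orthogonalized by Gram-Schmidt; the squared
   norm of the image under A (x) 1 then becomes a sum of squares |A x|^2, to which
   the frame inequality of the other factor applies. Density extends the
   inequality to all z; this costs a factor 4 in each constant, which is
   harmless. *)
Require Import Defs.
From mathcomp Require Import all_boot all_order all_algebra.
From mathcomp Require Import all_classical reals ereal esum.
From mathcomp Require Import complex ring lra.
From Stdlib Require Import ClassicalEpsilon.
Import Order.TTheory GRing.Theory Num.Theory.
Local Open Scope ring_scope.
Local Open Scope classical_set_scope.

Set Implicit Arguments.
Unset Strict Implicit.
Unset Printing Implicit Defensive.
Local Open Scope complex_scope.

Local Notation Re := complex.Re.
Local Notation Im := complex.Im.

(** * Inner products and convergence *)
Section Basics.
Variable R : realType.
Implicit Types X Y Z : hilbert R.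

Lemma ReD (a b : R[i]) : Re (a + b) = Re a + Re b.
Proof. by case: a b => [? ?] []. Qed.

Lemma ReN (a : R[i]) : Re (- a) = - Re a.
Proof. by case: a. Qed.

Lemma ReM_real (r : R) (a : R[i]) : Re (r%:C * a) = r * Re a.
Proof. by case: a => a b /=; rewrite mul0r subr0. Qed.

Lemma Re_conjc (a : R[i]) : Re (conjc a) = Re a.
Proof. by case: a. Qed.

Lemma Re_sum (T : Type) (s : seq T) (F : T -> R[i]) :
  Re (\sum_(i <- s) F i) = \sum_(i <- s) Re (F i).
Proof. exact: (big_morph _ ReD). Qed.

Lemma hdotDl X (x y z : X) : hdot (x + y) z = hdot x z + hdot y z.
Proof. by have := hdot_linl 1 x y z; rewrite scale1r mul1r. Qed.

Lemma hdot0l X (z : X) : hdot 0 z = 0.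
Proof. by have := hdotDl 0 0 z; rewrite addr0 -{1}[hdot 0 z]addr0 => /addrI. Qed.

Lemma hdotZl X (a : R[i]) (x z : X) : hdot (a *: x) z = a * hdot x z.
Proof. by have := hdot_linl a x 0 z; rewrite addr0 hdot0l addr0. Qed.

Lemma hdotNl X (x z : X) : hdot (- x) z = - hdot x z.
Proof. by rewrite -scaleN1r hdotZl mulN1r. Qed.

Lemma hdotBl X (x y z : X) : hdot (x - y) z = hdot x z - hdot y z.
Proof. by rewrite hdotDl hdotNl. Qed.

Lemma hdotDr X (x y z : X) : hdot z (x + y) = hdot z x + hdot z y.
Proof. by rewrite hdot_sym hdotDl rmorphD /= -!hdot_sym. Qed.

Lemma hdot0r X (z : X) : hdot z 0 = 0.
Proof. by rewrite hdot_sym hdot0l rmorph0. Qed.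

Lemma hdotZr X (a : R[i]) (x z : X) : hdot z (a *: x) = conjc a * hdot z x.
Proof. by rewrite hdot_sym hdotZl rmorphM /= -hdot_sym. Qed.

Lemma hdotNr X (x z : X) : hdot z (- x) = - hdot z x.
Proof. by rewrite hdot_sym hdotNl rmorphN /= -hdot_sym. Qed.

Lemma hdotBr X (x y z : X) : hdot z (x - y) = hdot z x - hdot z y.
Proof. by rewrite hdotDr hdotNr. Qed.

Lemma hdot_suml X (T : Type) (s : seq T) (F : T -> X) z :
  hdot (\sum_(i <- s) F i) z = \sum_(i <- s) hdot (F i) z.
Proof. exact: (big_morph (fun x => hdot x z) (fun x y => hdotDl x y z) (hdot0l z)). Qed.

Lemma hdot_sumr X (T : Type) (s : seq T) (F : T -> X) z :
  hdot z (\sum_(i <- s) F i) = \sum_(i <- s) hdot z (F i).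
Proof. exact: (big_morph _ (fun x y => hdotDr x y z) (hdot0r z)). Qed.

(** Estimates are carried out on squared norms, so that they stay polynomial. The triangle
    inequality is replaced by [sqnD_le], whose factor 2 is the source of most constants 2 and 4
    below. *)
Definition sqn X (x : X) : R := Re (hdot x x).

Lemma hdotxx X (x : X) : hdot x x = (sqn x)%:C.
Proof.
have := hdot_pos x; rewrite /sqn; case: (hdot x x) => a b.
by rewrite lecE /= => /andP[/eqP -> _].
Qed.

Lemma sqn_ge0 X (x : X) : 0 <= sqn x.
Proof. by have := hdot_pos x; rewrite hdotxx ler0c. Qed.

Lemma sqn_eq0 X (x : X) : sqn x = 0 -> x = 0.
Proof. by move=> h; apply: hdot_def; rewrite hdotxx h. Qed.

Lemma sqn0 X : sqn (0 : X) = 0.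
Proof. by rewrite /sqn hdot0l. Qed.

Lemma sqnZ X (a : R[i]) (x : X) : sqn (a *: x) = (Re a ^+ 2 + Im a ^+ 2) * sqn x.
Proof.
rewrite /sqn hdotZl hdotZr hdotxx; case: a => a b /=; ring.
Qed.

Lemma sqnN X (x : X) : sqn (- x) = sqn x.
Proof. by rewrite /sqn hdotNl hdotNr opprK. Qed.

Lemma sqnBC X (x y : X) : sqn (x - y) = sqn (y - x).
Proof. by rewrite -sqnN opprB. Qed.

Lemma Re_hdotC X (x y : X) : Re (hdot x y) = Re (hdot y x).
Proof. by rewrite hdot_sym Re_conjc. Qed.

Lemma sqnD X (x y : X) : sqn (x + y) = sqn x + 2 * Re (hdot x y) + sqn y.
Proof.
rewrite /sqn hdotDl !hdotDr !ReD (Re_hdotC y x); ring.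
Qed.

Lemma parallelogram X (x y : X) : sqn (x + y) + sqn (x - y) = 2 * sqn x + 2 * sqn y.
Proof. rewrite !sqnD sqnN hdotNr ReN; ring. Qed.

Lemma sqnD_le X (x y : X) : sqn (x + y) <= 2 * sqn x + 2 * sqn y.
Proof. have := parallelogram x y; have := sqn_ge0 (x - y); lra. Qed.

Lemma sqn_le_dist X (x y : X) : sqn x <= 2 * sqn y + 2 * sqn (x - y).
Proof. by have := sqnD_le y (x - y); rewrite addrC subrK. Qed.

Lemma sqn_dist_trans X (x y z : X) : sqn (x - z) <= 2 * sqn (x - y) + 2 * sqn (y - z).
Proof. by have := sqnD_le (x - y) (y - z); rewrite addrA subrK. Qed.

Lemma hnorm_sqr X (x : X) : hnorm x ^+ 2 = sqn x.
Proof. by rewrite sqr_sqrtr // sqn_ge0. Qed.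

Lemma hnorm_ge0 X (x : X) : 0 <= hnorm x.
Proof. exact: sqrtr_ge0. Qed.

Lemma hdot_injl X (x y : X) : (forall z, hdot x z = hdot y z) -> x = y.
Proof.
move=> h; apply/eqP; rewrite -subr_eq0; apply/eqP/hdot_def.
by rewrite hdotBl h subrr.
Qed.

(** Replacing [y] by ['i *: y] turns the imaginary part into a real part, so variational arguments
    need to treat real parts only. *)
Lemma hdot_eq0_Re X (x : X) (P : X -> Prop) :
  (forall y, P y -> P ('i *: y)) -> (forall y, P y -> Re (hdot x y) = 0) ->
  forall y, P y -> hdot x y = 0.
Proof.
move=> Pi h y Py; have := h _ Py; have := h _ (Pi _ Py).
rewrite hdotZr; case: (hdot x y) => a b /= h1 ->.
suff -> : b = 0 by [].
lra.
Qed.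

(** Discriminant of a nonnegative quadratic polynomial, evaluated at its minimizer [- b / c]. *)
Lemma psd_form_CS (a b c : R) : 0 <= c ->
  (forall t : R, 0 <= a + 2 * t * b + t ^+ 2 * c) -> b ^+ 2 <= a * c.
Proof.
move=> c0 h; have [c00|c0'] := eqVneq c 0.
  have [b0|b0] := eqVneq b 0; first by rewrite b0 c00 expr0n /= mulr0.
  (* For [c = 0] the polynomial is affine with nonzero slope; this point gives it the value -1. *)
  have := h (- (a + 1) / (2 * b)); rewrite c00 mulr0 addr0.
  have -> : 2 * (- (a + 1) / (2 * b)) * b = - (a + 1) by field.
  lra.
have cp : 0 < c by rewrite lt0r c0' c0.
have := h (- b / c).
have -> : a + 2 * (- b / c) * b + (- b / c) ^+ 2 * c = (a * c - b ^+ 2) / c by field.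
by rewrite pmulr_lge0 ?invr_gt0 // subr_ge0.
Qed.

Definition selfadj X (T : X -> X) := forall x y, hdot (T x) y = hdot x (T y).

(** Moving [T] to the other side of the inner product makes linearity automatic, which is why
    [selfadj] does not include it. *)
Lemma selfadj_lin X (T : X -> X) : selfadj T -> lin_op T.
Proof.
move=> sT a x y; apply: hdot_injl => z.
by rewrite sT hdotDl hdotZl hdotDl hdotZl !sT.
Qed.

Lemma lin_opD X Y (A : X -> Y) : lin_op A -> forall x y, A (x + y) = A x + A y.
Proof. by move=> h x y; have := h 1 x y; rewrite !scale1r. Qed.

Lemma lin_op0 X Y (A : X -> Y) : lin_op A -> A 0 = 0.
Proof. by move=> h; have := lin_opD h 0 0; rewrite addr0 -{1}[A 0]addr0 => /addrI. Qed.

Lemma lin_opZ X Y (A : X -> Y) : lin_op A -> forall a x, A (a *: x) = a *: A x.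
Proof. by move=> h a x; have := h a x 0; rewrite !addr0 (lin_op0 h) addr0. Qed.

Lemma lin_opN X Y (A : X -> Y) : lin_op A -> forall x, A (- x) = - A x.
Proof. by move=> h x; rewrite -scaleN1r (lin_opZ h) scaleN1r. Qed.

Lemma lin_opB X Y (A : X -> Y) : lin_op A -> forall x y, A (x - y) = A x - A y.
Proof. by move=> h x y; rewrite (lin_opD h) (lin_opN h). Qed.

Lemma lin_op_sum X Y (A : X -> Y) : lin_op A -> forall (T : Type) (s : seq T) (F : T -> X),
  A (\sum_(i <- s) F i) = \sum_(i <- s) A (F i).
Proof. by move=> h T s F; apply: (big_morph A (lin_opD h) (lin_op0 h)). Qed.

Lemma selfadj_CS X (T : X -> X) : selfadj T -> (forall x, 0 <= Re (hdot (T x) x)) ->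
  forall x y, Re (hdot (T x) y) ^+ 2 <= Re (hdot (T x) x) * Re (hdot (T y) y).
Proof.
move=> sT pT x y; apply: psd_form_CS => // t.
have := pT (x + t%:C *: y).
rewrite (lin_opD (selfadj_lin sT)) (lin_opZ (selfadj_lin sT)).
rewrite !hdotDl !hdotDr !hdotZl !hdotZr conjc_real !ReD !ReM_real.
rewrite (sT y x) (Re_hdotC y); set p := Re _; set q := Re _; set r := Re _.
by rewrite (_ : p + t * q + (t * q + t * (t * r)) = p + 2 * t * q + t ^+ 2 * r) //; ring.
Qed.

Lemma hdot_CS X (x y : X) : Re (hdot x y) ^+ 2 <= sqn x * sqn y.
Proof. by apply: (@selfadj_CS X id) => //; apply: sqn_ge0. Qed.

Lemma hconvP X (u : nat -> X) (x : X) :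
  hconv u x <-> forall e : R, 0 < e -> exists N : nat, forall n, (N <= n)%N -> sqn (u n - x) < e.
Proof.
split=> h e e0.
  have [|N hN] := h (Num.sqrt e); first by rewrite sqrtr_gt0.
  by exists N => n /hN; rewrite ltr_sqrt.
have [|N hN] := h (e ^+ 2); first by rewrite exprn_gt0.
exists N => n /hN; rewrite -hnorm_sqr.
by rewrite ltr_pXn2r // nnegrE ?hnorm_ge0 // ltW.
Qed.

Lemma inv_nat_lt (e : R) : 0 < e -> exists N : nat, forall n, (N <= n)%N -> n.+1%:R^-1 < e.
Proof.
move=> e0; have [N hN] : exists N : nat, e^-1 < N%:R.
  exists (Num.bound e^-1); apply: le_lt_trans (archi_boundP _); last by rewrite invr_ge0 ltW.
  by [].
exists N => n Nn; rewrite invf_plt ?posrE //; apply: (lt_le_trans hN).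
by rewrite ler_nat (leq_trans Nn).
Qed.

(** The explicit rate is what sequences picked with precision [n.+1%:R^-1] provide: minimizing
    sequences, partial sums, dense approximations. *)
Lemma cauchy_sqn X (u : nat -> X) (a : R) :
  (forall m n, sqn (u m - u n) <= a * (m.+1%:R^-1 + n.+1%:R^-1)) ->
  exists x, hconv u x.
Proof.
move=> h; apply: hcomplete => e e0.
have a1 : 0 < `|a| + 1 by rewrite ltr_pwDr.
have [|N hN] := @inv_nat_lt (e ^+ 2 / (2 * (`|a| + 1))).
  by rewrite divr_gt0 ?exprn_gt0 // mulr_gt0.
exists N => m n Nm Nn; rewrite -/(hnorm _).
rewrite -(ltr_pXn2r (n := 2)) ?nnegrE ?hnorm_ge0 ?ltW // hnorm_sqr.
apply: (le_lt_trans (h m n)).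
have := hN _ Nm; have := hN _ Nn; 
set p := n.+1%:R^-1; set q := m.+1%:R^-1 => hp hq.
have p0 : 0 < p by rewrite invr_gt0.
have q0 : 0 < q by rewrite invr_gt0.
have : p + q < e ^+ 2 / (`|a| + 1).
  have -> : e ^+ 2 / (`|a| + 1) =
    e ^+ 2 / (2 * (`|a| + 1)) + e ^+ 2 / (2 * (`|a| + 1)) by field; lra.
  lra.
rewrite ltr_pdivlMr //; apply: le_lt_trans.
rewrite (addrC q) mulrC ler_wpM2l //; first lra.
have := ler_norm a; lra.
Qed.

End Basics.

(** * Orthogonal projections, Riesz representation and adjoints *)
Section Operators.
Variable R : realType.
Implicit Types X Y Z : hilbert R.

Lemma le_approx (a b c : R) : 0 <= c -> (forall e, 0 < e -> a <= b + c * e) -> a <= b.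
Proof.
move=> c0 h; apply/ler_addgt0Pr => e e0; apply: (le_trans (h (e / (c + 1)) _)).
  by rewrite divr_gt0 // ltr_wpDl.
rewrite lerD2l mulrCA; apply: ler_piMr; first exact: ltW.
by rewrite ler_pdivrMr ?mul1r ?ltr_wpDl // lerDl.
Qed.

Definition normsq (c : R[i]) : R := Re c ^+ 2 + Im c ^+ 2.

Lemma normsqD (a b : R[i]) : normsq (a + b) <= 2 * normsq a + 2 * normsq b.
Proof.
case: a b => [a b] [c d]; rewrite /normsq /=.
have := sqr_ge0 (a - c); have := sqr_ge0 (b - d); nra.
Qed.

Lemma normsq_eq0 (c : R[i]) : normsq c <= 0 -> c = 0.
Proof.
case: c => a b; rewrite /normsq /= => h; have ha := sqr_ge0 a; have hb := sqr_ge0 b.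
have /eqP : a ^+ 2 = 0 by lra.
have /eqP : b ^+ 2 = 0 by lra.
by rewrite !sqrf_eq0 => /eqP -> /eqP ->.
Qed.

(** Cauchy-Schwarz is applied to the real and the imaginary part separately, hence the factor 2. *)
Lemma normsq_hdot X (x y : X) : normsq (hdot x y) <= 2 * (sqn x * sqn y).
Proof.
have h1 := hdot_CS x y; have h2 := hdot_CS x ('i *: y).
rewrite sqnZ /= expr0n expr1n add0r mul1r in h2.
have e : Im (hdot x y) = Re (hdot x ('i *: y)).
  by rewrite hdotZr; case: (hdot _ _) => a b /=; ring.
rewrite /normsq e; lra.
Qed.

Lemma subspaceB X (V : set X) : closed_subspace V -> forall x y, V x -> V y -> V (x - y).
Proof. by move=> [_ [h _]] x y Vx Vy; rewrite -(scaleN1r y) addrC; apply: h. Qed.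

Lemma subspaceZ X (V : set X) : closed_subspace V -> forall a x, V x -> V (a *: x).
Proof. by move=> [h0 [h _]] a x Vx; rewrite -[_ *: _]addr0; apply: h. Qed.

Lemma subspaceD X (V : set X) : closed_subspace V -> forall x y, V x -> V y -> V (x + y).
Proof. by move=> [_ [h _]] x y Vx Vy; rewrite -(scale1r x); apply: h. Qed.

(** The parallelogram law makes a sequence minimizing the distance to [x] a Cauchy sequence; its
    limit is the foot of the perpendicular. *)
Lemma proj_exists X (V : set X) (x : X) : closed_subspace V ->
  exists p, V p /\ forall y, V y -> hdot (x - p) y = 0.
Proof.
move=> cV; have [V0 [_ Vcl]] := cV.
pose E : set R := [set sqn (x - v) | v in V].
have infE : has_inf E.
  split; first by exists (sqn (x - 0)), 0.
  by exists 0 => _ [v _ <-]; apply: sqn_ge0.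
have Eub v : V v -> inf E <= sqn (x - v).
  by move=> Vv; apply: ge_inf; [case: infE|exists v].
have /choice [u hu] : forall n : nat, exists v, V v /\ sqn (x - v) < inf E + n.+1%:R^-1.
  move=> n; have [|_ [v Vv <-] hv] := @inf_adherent _ E (n.+1%:R^-1) _ infE.
    by rewrite invr_gt0.
  by exists v.
have [|p up] := @cauchy_sqn _ _ u 2.
  move=> m n; have [Vm hm] := hu m; have [Vn hn] := hu n.
  have := parallelogram (x - u m) (x - u n).
  have -> : x - u m - (x - u n) = - (u m - u n).
    by rewrite !opprB addrC addrA subrK.
  rewrite sqnN.
  have := Eub _ (subspaceZ cV (2^-1)%:C (subspaceD cV Vm Vn)).
  have -> : sqn (x - u m + (x - u n)) = 4 * sqn (x - (2^-1)%:C *: (u m + u n)).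
    have -> : x - u m + (x - u n) = 2%:C *: (x - (2^-1)%:C *: (u m + u n)).
      rewrite scalerBr scalerA -rmorphM /= mulfV ?pnatr_eq0 // rmorph1 scale1r.
      by rewrite rmorphD rmorph1 scalerDl scale1r addrACA -opprD.
    by rewrite sqnZ /=; congr (_ * _); ring.
  set p := m.+1%:R^-1 in hm *; set q := n.+1%:R^-1 in hn *.
  move=> h1 h2; lra.
have Vp : V p by apply: (Vcl u) => // n; case: (hu n).
exists p; split=> // y; move: y; apply: hdot_eq0_Re => [y Vy|y Vy]; first exact: subspaceZ.
suff : Re (hdot (x - p) y) ^+ 2 <= 0.
  by move=> h; apply/eqP; rewrite -sqrf_eq0 eq_le h sqr_ge0.
(* Moving from [u n] by a multiple of [y] can lower the squared distance by at most [n.+1%:R^-1], so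
   the discriminant bound shows that [x - u n] is almost orthogonal to [y]. *)
have hn n : Re (hdot (x - u n) y) ^+ 2 <= n.+1%:R^-1 * sqn y.
  apply: psd_form_CS => [|t]; first exact: sqn_ge0.
  have [Vn hn] := hu n.
  have := Eub _ (subspaceB cV Vn (subspaceZ cV t%:C Vy)).
  rewrite opprB addrCA addrC sqnD sqnZ /= hdotZr conjc_real ReM_real.
  set q := n.+1%:R^-1 in hn *; lra.
apply: (@le_approx _ _ (4 * sqn y)) => [|e e0]; first by rewrite mulr_ge0 ?sqn_ge0.
have [N1 h1] := inv_nat_lt e0; have [N2 h2] := (hconvP _ _).1 up _ e0.
set n := maxn N1 N2.
have hp : sqn (u n - p) <= e by rewrite ltW // h2 // leq_maxr.
have he : n.+1%:R^-1 <= e by rewrite ltW // h1 // leq_maxl.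
have e1 := le_trans (hn n) (ler_wpM2r (sqn_ge0 y) he).
have e2 := le_trans (hdot_CS (u n - p) y) (ler_wpM2r (sqn_ge0 y) hp).
have -> : x - p = x - u n + (u n - p) by rewrite addrA subrK.
rewrite hdotDl ReD add0r.
set a := Re _ in e1 *; set b := Re _ in e2 *.
have := sqr_ge0 (a - b); nra.
Qed.

Lemma hprojP X (V : set X) x : closed_subspace V ->
  V (hproj V x) /\ forall y, V y -> hdot (x - hproj V x) y = 0.
Proof. by move=> cV; exact: epsilon_spec (proj_exists x cV). Qed.

Lemma hproj_in X (V : set X) x : closed_subspace V -> V (hproj V x).
Proof. by move=> cV; have [] := hprojP x cV. Qed.

Lemma hproj_orth X (V : set X) x : closed_subspace V ->
  forall y, V y -> hdot (x - hproj V x) y = 0.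
Proof. by move=> cV; have [] := hprojP x cV. Qed.

Lemma hproj_uniq X (V : set X) x p : closed_subspace V ->
  V p -> (forall y, V y -> hdot (x - p) y = 0) -> hproj V x = p.
Proof.
move=> cV Vp hp; apply/eqP; rewrite -subr_eq0; apply/eqP/hdot_def.
have Vd : V (hproj V x - p) by apply: subspaceB => //; apply: hproj_in.
rewrite {1}(_ : hproj V x - p = (x - p) - (x - hproj V x)).
  by rewrite hdotBl hp // hproj_orth // subrr.
by rewrite opprB [RHS]addrC addrA subrK.
Qed.

Lemma hproj_selfadj X (V : set X) : closed_subspace V -> selfadj (hproj V).
Proof.
move=> cV x y; have Py := hproj_in y cV; have Px := hproj_in x cV.
have := hproj_orth x cV Py; rewrite hdotBl => /eqP; rewrite subr_eq0 => /eqP ->.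
have := hproj_orth y cV Px; rewrite hdotBl => /eqP; rewrite subr_eq0 => /eqP h.
by rewrite hdot_sym h -hdot_sym.
Qed.

Lemma sqn_hproj_le X (V : set X) x : closed_subspace V -> sqn (hproj V x) <= sqn x.
Proof.
move=> cV; have := sqnD (x - hproj V x) (hproj V x); rewrite subrK => ->.
rewrite (hproj_orth x cV (hproj_in x cV)) (_ : Re 0 = 0) // mulr0 addr0 lerDr.
exact: sqn_ge0.
Qed.

Lemma bounded_opP X Y (A : X -> Y) :
  bounded_op A <-> lin_op A /\ exists2 M : R, 0 <= M & forall x, sqn (A x) <= M * sqn x.
Proof.
split=> -[lA hA]; split=> //.
  have [M hM] := hA; exists (M ^+ 2) => [|x]; first exact: sqr_ge0.
  rewrite -!hnorm_sqr -exprMn ler_pXn2r // ?nnegrE ?hnorm_ge0 //.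
  exact: le_trans (hnorm_ge0 _) (hM x).
have [M M0 hM] := hA; exists (Num.sqrt M) => x.
by rewrite /hnorm -sqrtrM // ler_sqrt ?mulr_ge0 // ?sqn_ge0 // hM.
Qed.

Lemma bounded_op_comp X Y Z (B : Y -> Z) (A : X -> Y) :
  bounded_op B -> bounded_op A -> bounded_op (B \o A).
Proof.
move=> /bounded_opP[lB [M M0 hB]] /bounded_opP[lA [N N0 hA]]; apply/bounded_opP; split.
  by move=> a x y /=; rewrite lA lB.
exists (M * N) => [|x /=]; first exact: mulr_ge0.
by rewrite (le_trans (hB _)) // -mulrA ler_wpM2l.
Qed.

Lemma bounded_hproj X (V : set X) : closed_subspace V -> bounded_op (hproj V).
Proof.
move=> cV; apply/bounded_opP; split; first exact/selfadj_lin/hproj_selfadj.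
by exists 1 => // x; rewrite mul1r sqn_hproj_le.
Qed.

(** The bound makes the kernel [N] closed. If [f] is not zero, some [u] orthogonal to [N] has
    [f u != 0], and since [z - (f z / f u) *: u] lies in [N], pairing it with [u] recovers [f z]. *)
Lemma riesz X (f : X -> R[i]) (M : R) :
  (forall a x y, f (a *: x + y) = a * f x + f y) ->
  (forall x, normsq (f x) <= M * sqn x) ->
  exists x, forall z, f z = hdot z x.
Proof.
move=> lf bf.
have fD x y : f (x + y) = f x + f y by have := lf 1 x y; rewrite scale1r mul1r.
have f0 : f 0 = 0 by have := fD 0 0; rewrite addr0 -{1}[f 0]addr0 => /addrI.
have fZ a x : f (a *: x) = a * f x by have := lf a x 0; rewrite !addr0 f0 addr0.
have fB x y : f (x - y) = f x - f y by rewrite fD -scaleN1r fZ mulN1r.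
pose N : set X := [set z | f z = 0].
have cN : closed_subspace N.
  split=> //; split=> [a x y Nx Ny|u x Nu ux].
    by rewrite /N /= lf Nx Ny mulr0 addr0.
  apply: normsq_eq0; apply: (@le_approx _ _ `|M|) => // e e0.
  have [n hn] := (hconvP _ _).1 ux _ e0.
  have := bf (x - u n); rewrite fB Nu subr0 sqnBC add0r => h; apply: (le_trans h).
  apply: le_trans (ler_wpM2l (normr_ge0 M) (ltW (hn n (leqnn n)))).
  by rewrite ler_wpM2r ?sqn_ge0 // ler_norm.
have [w|fw] := pselect (forall w, f w = 0).
  by exists 0 => z; rewrite hdot0r w.
have {fw} [w fw] : exists w, f w <> 0 by apply/existsNP.
set u := w - hproj N w.
have fu : f u != 0 by rewrite /u fB (hproj_in w cN) subr0; apply/eqP.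
have u0 : hdot u u != 0.
  by apply: contra fu => /eqP /hdot_def ->; rewrite f0.
exists ((conjc (f u) / hdot u u) *: u) => z.
have Nz : N (z - (f z / f u) *: u).
  by rewrite /N /= fB fZ divfK // subrr.
have : hdot (z - (f z / f u) *: u) u = 0.
  by rewrite hdot_sym (hproj_orth w cN Nz) rmorph0.
rewrite hdotBl hdotZl => /eqP; rewrite subr_eq0 => /eqP h.
rewrite hdotZr h rmorphM /= conjcK fmorphV /= -hdot_sym.
by field; rewrite fu u0.
Qed.

Lemma adj_exists X Y (A : X -> Y) y : bounded_op A ->
  exists x, forall z, hdot (A z) y = hdot z x.
Proof.
move=> /bounded_opP[lA [M M0 hM]].
apply: (@riesz _ (fun z => hdot (A z) y) (2 * (M * sqn y))) => [a x z|x].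
  by rewrite lA hdotDl hdotZl.
apply: le_trans (normsq_hdot _ _) _; rewrite -mulrA ler_pM2l // mulrAC.
by apply: ler_wpM2r; rewrite ?sqn_ge0.
Qed.

Lemma hadjP X Y (A : X -> Y) : bounded_op A ->
  forall y z, hdot (A z) y = hdot z (hadj A y).
Proof. by move=> bA y; exact: epsilon_spec (adj_exists y bA). Qed.

End Operators.

(** * The frame operator and its inverse *)
Section FrameOperator.
Variable R : realType.
Implicit Types X Y : hilbert R.

(** A subsequence with the rate of [cauchy_sqn] converges, and the whole sequence follows it. *)
Lemma cauchy_sqn_eps X (u : nat -> X) :
  (forall e : R, 0 < e -> exists N : nat, forall m n, (N <= m)%N -> (N <= n)%N ->
    sqn (u m - u n) <= e) -> exists x, hconv u x.
Proof.
move=> h; have /choice [N hN] : forall k : nat, exists N : nat, forall m n,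
    (N <= m)%N -> (N <= n)%N -> sqn (u m - u n) <= k.+1%:R^-1.
  by move=> k; apply: h; rewrite invr_gt0.
have [|x hx] := @cauchy_sqn _ _ (fun k => u (N k)) 1.
  move=> m n; have [mn|nm] := leqP (N m) (N n).
    by apply: le_trans (hN m _ _ _ mn) _ => //; rewrite mul1r lerDl invr_ge0.
  by apply: le_trans (hN n _ _ (ltnW nm) _) _ => //; rewrite mul1r lerDr invr_ge0.
exists x; apply/hconvP => e e0.
have e4 : 0 < e / 4 by lra.
have [M1 h1] := (hconvP _ _).1 hx _ e4; have [M2 h2] := inv_nat_lt e4.
set k := maxn M1 M2; exists (N k) => n hn.
have := h1 k (leq_maxl _ _); have := h2 k (leq_maxr _ _).
have := hN k n (N k) hn (leqnn _); have := sqn_dist_trans (u n) (u (N k)) x.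
set i := k.+1%:R^-1; lra.
Qed.

Lemma hconv_uniq X (u : nat -> X) x y : hconv u x -> hconv u y -> x = y.
Proof.
move=> /hconvP hx /hconvP hy; apply/eqP; rewrite -subr_eq0; apply/eqP/sqn_eq0/eqP.
rewrite eq_le sqn_ge0 andbT; apply: (@le_approx _ _ _ 4) => // e e0.
have [n1 h1] := hx _ e0; have [n2 h2] := hy _ e0; set n := maxn n1 n2.
have := h1 n (leq_maxl _ _); have := h2 n (leq_maxr _ _).
have := sqn_dist_trans x (u n) y; rewrite (sqnBC x (u n)); lra.
Qed.

Lemma bounded_hconv X Y (A : X -> Y) (u : nat -> X) x :
  bounded_op A -> hconv u x -> hconv (A \o u) (A x).
Proof.
move=> /bounded_opP[lA [M M0 hM]] /hconvP ux; apply/hconvP => e e0.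
have M1 : 0 < M + 1 by rewrite ltr_wpDl.
have [|N hN] := ux (e / (M + 1)); first by rewrite divr_gt0.
exists N => n /hN; rewrite ltr_pdivlMr //= -(lin_opB lA).
have := hM (u n - x); have := sqn_ge0 (u n - x); lra.
Qed.

Variables (X : hilbert R) (T : eqType) (I : set T) (F : T -> X -> X).

Definition finsub (s : seq T) := uniq s /\ (forall p, p \in s -> I p).

Lemma finsub_undup_cat s s' : finsub s -> finsub s' -> finsub (undup (s ++ s')).
Proof.
move=> [_ h] [_ h']; split; first exact: undup_uniq.
by move=> p; rewrite mem_undup mem_cat => /orP[/h|/h'].
Qed.

Lemma sub_undup_catl (s s' : seq T) : {subset s <= undup (s ++ s')}.
Proof. by move=> p ps; rewrite mem_undup mem_cat ps. Qed.

Lemma sub_undup_catr (s s' : seq T) : {subset s' <= undup (s ++ s')}.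
Proof. by move=> p ps; rewrite mem_undup mem_cat ps orbT. Qed.

Lemma finsub_filter (P : pred T) s : finsub s -> finsub [seq p <- s | P p].
Proof.
move=> [u h]; split; first exact: filter_uniq.
by move=> p; rewrite mem_filter => /andP[_ /h].
Qed.

Lemma sum_split_mem (V : nmodType) (s s' : seq T) (G : T -> V) :
  uniq s -> uniq s' -> {subset s <= s'} ->
  \sum_(p <- s') G p = \sum_(p <- s) G p + \sum_(p <- s' | p \notin s) G p.
Proof.
move=> us us' ss'; rewrite (bigID (mem s)) /= -big_filter; congr (_ + _).
apply: perm_big; apply: uniq_perm; rewrite ?filter_uniq // => p.
by rewrite mem_filter; case: (boolP (p \in s)) => // /ss'.
Qed.

Lemma has_usumP (G : T -> X) x :
  has_usum I G x <-> forall e : R, 0 < e -> exists s0, finsub s0 /\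
    forall s1, finsub s1 -> {subset s0 <= s1} -> sqn (\sum_(p <- s1) G p - x) < e.
Proof.
split=> h e e0.
  have [|s0 [I0 h0]] := h (Num.sqrt e); first by rewrite sqrtr_gt0.
  exists (undup s0); split.
    by split=> [|p]; rewrite ?undup_uniq // mem_undup => /I0.
  move=> s1 [u1 I1] ss; have := h0 s1 u1 _ I1.
  rewrite /hnorm ltr_sqrt //; apply=> p ps; apply: ss; by rewrite mem_undup.
have [|s0 [[u0 I0] h0]] := h (e ^+ 2); first by rewrite exprn_gt0.
exists s0; split=> // s1 u1 ss I1.
have := h0 s1 (conj u1 I1) ss; rewrite -hnorm_sqr.
by rewrite ltr_pXn2r // nnegrE ?hnorm_ge0 // ltW.
Qed.

(** Both frame bounds are phrased through finite subsums, which keeps the operator theory free of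
    extended reals; in [frame_lower] the error [e] replaces the supremum. *)
Definition bessel (b : R) := 0 <= b /\ forall s, finsub s -> forall z,
  \sum_(p <- s) Re (hdot (F p z) z) <= b * sqn z.

Definition frame_lower (a : R) := 0 < a /\ forall z (e : R), 0 < e ->
  exists s, finsub s /\ a * sqn z <= \sum_(p <- s) Re (hdot (F p z) z) + e.

Hypothesis Fsa : forall p, I p -> selfadj (F p).
Hypothesis Fpsd : forall p, I p -> forall z, 0 <= Re (hdot (F p z) z).

Definition psum s z := \sum_(p <- s) F p z.

Lemma psum_selfadj s : finsub s -> selfadj (psum s).
Proof.
move=> [_ h] x y; rewrite /psum hdot_suml hdot_sumr.
by apply: eq_big_seq => p /h Ip; apply: Fsa.
Qed.

Lemma psum_form s z : Re (hdot (psum s z) z) = \sum_(p <- s) Re (hdot (F p z) z).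
Proof. by rewrite /psum hdot_suml Re_sum. Qed.

Lemma psum_psd s z : finsub s -> 0 <= Re (hdot (psum s z) z).
Proof.
move=> [_ h]; rewrite psum_form big_seq; apply: sumr_ge0 => p /h Ip; exact: Fpsd.
Qed.

Lemma psum_mono s s' z : finsub s -> finsub s' -> {subset s <= s'} ->
  Re (hdot (psum s z) z) <= Re (hdot (psum s' z) z).
Proof.
move=> fs fs' ss; rewrite !psum_form (sum_split_mem _ fs.1 fs'.1 ss) lerDl.
by rewrite big_seq_cond; apply: sumr_ge0 => p /andP[/fs'.2 Ip _]; apply: Fpsd.
Qed.

(** With [y = psum s z], Cauchy-Schwarz for the positive form of [psum s] bounds [sqn y ^+ 2] by the
    form at [z] times the form at [y]. The latter is at most [b * sqn y], and one factor [sqn y]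
    cancels. *)
Lemma sqn_psum_le (b : R) (hb : bessel b) s z :
  finsub s -> sqn (psum s z) <= b * Re (hdot (psum s z) z).
Proof.
have [b0 Fub] := hb.
move=> fs; set y := psum s z.
have := selfadj_CS (psum_selfadj fs) (fun x => psum_psd x fs) z y.
rewrite -/y -/(sqn y) (psum_form s y) => h.
have h' := le_trans h (ler_wpM2l (psum_psd z fs) (Fub _ fs y)); rewrite -/y in h'.
have [y0|y0] := eqVneq (sqn y) 0.
  by rewrite y0 mulr_ge0 // psum_psd.
have yp : 0 < sqn y by rewrite lt0r y0 sqn_ge0.
rewrite -(ler_pM2r yp) -expr2; apply: (le_trans h').
by rewrite mulrCA mulrA.
Qed.

(** The forms of finite subsums have a finite supremum; a subset [s0] within [e] of it leaves at
    most [e] for anything disjoint from [s0]. *)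
Lemma psum_tail (b : R) (hb : bessel b) z (e : R) : 0 < e -> exists s0, finsub s0 /\
  forall s, finsub s -> (forall p, p \in s -> p \notin s0) -> Re (hdot (psum s z) z) <= e.
Proof.
have [b0 Fub] := hb.
move=> e0; pose E : set R := [set Re (hdot (psum s z) z) | s in finsub].
have ubE : ubound E (b * sqn z).
  by move=> _ [s fs <-]; rewrite psum_form; apply: Fub.
have supE : has_sup E.
  split; last by exists (b * sqn z).
  by exists (Re (hdot (psum [::] z) z)), [::].
have [_ [s0 f0 <-] h0] := sup_adherent e0 supE.
exists s0; split=> // s fs dis.
have fc : finsub (s0 ++ s).
  split=> [|p]; last by rewrite mem_cat => /orP[/f0.2|/fs.2].
  rewrite cat_uniq f0.1 fs.1 andbT /=; apply/hasPn => p /dis.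
  by [].
have := ub_le_sup (proj2 supE) (imageP (fun s => Re (hdot (psum s z) z)) fc).
rewrite /= {1}/psum big_cat hdotDl ReD -/(psum s0 z) -/(psum s z); lra.
Qed.

Lemma psum_diff_le (b : R) (hb : bessel b) s0 s z (e : R) : finsub s0 -> finsub s ->
  (forall s, finsub s -> (forall p, p \in s -> p \notin s0) -> Re (hdot (psum s z) z) <= e) ->
  {subset s0 <= s} -> sqn (psum s z - psum s0 z) <= b * e.
Proof.
have [b0 Fub] := hb.
move=> f0 fs h ss; rewrite {1}/psum (sum_split_mem _ f0.1 fs.1 ss) -/(psum s0 z) addrC addKr.
rewrite -big_filter; have ff := finsub_filter (fun p => p \notin s0) fs.
apply: (le_trans (sqn_psum_le hb z ff)); apply: ler_wpM2l => //.
by apply: h => // p; rewrite mem_filter => /andP[].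
Qed.

(** Small tails in the form sense are small in norm by [sqn_psum_le]. The chosen sets [s n] need not
    be nested, so [s m] and [s n] are compared through their union. *)
Lemma has_usum_exists (b : R) (hb : bessel b) z : exists x, has_usum I (fun p => F p z) x.
Proof.
have [b0 Fub] := hb.
have /choice [s hs] : forall n : nat, exists s0, finsub s0 /\
    forall s, finsub s -> (forall p, p \in s -> p \notin s0) ->
    Re (hdot (psum s z) z) <= n.+1%:R^-1.
  by move=> n; apply: (psum_tail hb); rewrite invr_gt0.
have [|x hx] := @cauchy_sqn _ _ (fun n => psum (s n) z) (2 * b).
  move=> m n; have [fm hm] := hs m; have [fn hn] := hs n.
  have fu := finsub_undup_cat fm fn.
  have h1 := psum_diff_le hb fm fu hm (@sub_undup_catl _ _).
  have h2 := psum_diff_le hb fn fu hn (@sub_undup_catr _ _).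
  have := sqn_dist_trans (psum (s m) z) (psum (undup (s m ++ s n)) z) (psum (s n) z).
  rewrite (sqnBC (psum (s m) z) (psum (undup _) z)).
  set i := m.+1%:R^-1 in h1 *; set j := n.+1%:R^-1 in h2 *; lra.
exists x; apply/has_usumP => e e0.
have b3 : 0 < 2 * b + 3 by lra.
have e1 : 0 < e / (2 * b + 3) by rewrite divr_gt0.
have [M1 h1] := (hconvP _ _).1 hx _ e1; have [M2 h2] := inv_nat_lt e1.
set k := maxn M1 M2; have [fk hk] := hs k.
exists (s k); split=> // s1 f1 ss.
have h3 := psum_diff_le hb fk f1 hk ss.
have := sqn_dist_trans (psum s1 z) (psum (s k) z) x.
have /= h4 := h1 k (leq_maxl _ _).
have h5 := ler_wpM2l b0 (ltW (h2 k (leq_maxr _ _))).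
have e2 : e = (2 * b + 3) * (e / (2 * b + 3)) by rewrite mulrC divfK // gt_eqF.
set d := e / _ in e1 e2 h1 h2 h4 h5; rewrite -/(psum s1 z); set w := sqn (_ - x).
set i := k.+1%:R^-1 in h3 h5; lra.
Qed.

Definition frame_op z := usum I (fun p => F p z).

Lemma frame_opP (b : R) (hb : bessel b) z (e : R) : 0 < e -> exists s0, finsub s0 /\
    forall s1, finsub s1 -> {subset s0 <= s1} -> sqn (psum s1 z - frame_op z) < e.
Proof.
have [b0 Fub] := hb.
by move: e; apply/has_usumP; exact: epsilon_spec (has_usum_exists hb z).
Qed.

Lemma frame_op_selfadj (b : R) (hb : bessel b) : selfadj frame_op.
Proof.
move=> x y; apply/eqP; rewrite -subr_eq0; apply/eqP/normsq_eq0.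
apply: (@le_approx _ _ _ (4 * (sqn x + sqn y))) => [|e e0].
  by rewrite mulr_ge0 // addr_ge0 ?sqn_ge0.
have [s1 [f1 h1]] := frame_opP hb x e0; have [s2 [f2 h2]] := frame_opP hb y e0.
have fu := finsub_undup_cat f1 f2; set s := undup _ in fu.
have {}h1 := h1 s fu (@sub_undup_catl _ _); have {}h2 := h2 s fu (@sub_undup_catr _ _).
have -> : hdot (frame_op x) y - hdot x (frame_op y) =
    - hdot (psum s x - frame_op x) y + hdot x (psum s y - frame_op y).
  by rewrite hdotBl hdotBr (psum_selfadj fu x y) opprB addrA subrK.
apply: (le_trans (normsqD _ _)); rewrite -hdotNl.
have := normsq_hdot (- (psum s x - frame_op x)) y; have := normsq_hdot x (psum s y - frame_op y).
rewrite sqnN; have := ler_wpM2r (sqn_ge0 y) (ltW h1); have := ler_wpM2l (sqn_ge0 x) (ltW h2).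
lra.
Qed.

Lemma frame_op_bounded (b : R) (hb : bessel b) : bounded_op frame_op.
Proof.
have [b0 Fub] := hb.
apply/bounded_opP; split; first exact/selfadj_lin/(frame_op_selfadj hb).
exists (2 * b ^+ 2) => [|z]; first by rewrite mulr_ge0 ?sqr_ge0.
apply: (@le_approx _ _ _ 2) => // e e0.
have [s [fs hs]] := frame_opP hb z e0; have {}hs := hs s fs (fun p h => h).
have := sqn_le_dist (frame_op z) (psum s z); rewrite (sqnBC (frame_op z)).
have := sqn_psum_le hb z fs; rewrite psum_form.
have := ler_wpM2l b0 (Fub _ fs z); lra.
Qed.

(** The lower bound passes from a large finite subsum to its limit; positivity of the terms allows
    the subset from [frame_lower] to be enlarged. *)
Lemma frame_op_ge (a b : R) (ha : frame_lower a) (hb : bessel b) z :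
  a * sqn z <= Re (hdot (frame_op z) z).
Proof.
have [b0 Fub] := hb. have [a0 Flb] := ha.
apply: (@le_approx _ _ _ (2 + sqn z)) => [|e e0]; first by rewrite addr_ge0 ?sqn_ge0.
have [s1 [f1 h1]] := Flb z _ e0.
have [|s2 [f2 h2]] := @frame_opP _ hb z (e ^+ 2); first by rewrite exprn_gt0.
have fu := finsub_undup_cat f1 f2; set s := undup _ in fu.
have {}h2 := h2 s fu (@sub_undup_catr _ _).
have := psum_mono z f1 fu (@sub_undup_catl _ _); rewrite psum_form => h3.
have := hdot_CS (psum s z - frame_op z) z; rewrite hdotBl ReD ReN.
have := ler_wpM2r (sqn_ge0 z) (ltW h2); have z0 := sqn_ge0 z.
set p := Re (hdot (psum _ _) _) in h3 *; set q := Re _ => k1 k2.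
(* The approximation within [e ^+ 2] costs [e] times the norm of [z], and that norm is at most
   [1 + sqn z]; this avoids square roots. *)
suff : p - q <= e * (1 + sqn z) by lra.
rewrite leNgt; apply/negP => k3.
have k4 : 0 <= e * (1 + sqn z) by rewrite mulr_ge0 ?addr_ge0 // ltW.
have : (e * (1 + sqn z)) ^+ 2 < (p - q) ^+ 2 by rewrite ltr_pXn2r // nnegrE ltW // (le_lt_trans k4).
have : e ^+ 2 * sqn z <= (e * (1 + sqn z)) ^+ 2.
  rewrite exprMn ler_wpM2l ?sqr_ge0 //; nra.
lra.
Qed.

(** Cauchy-Schwarz turns the lower bound on the form into a lower bound on the norm, from which
    injectivity, closed range and the bound on the inverse all follow. *)
Lemma frame_op_coercive (a b : R) (ha : frame_lower a) (hb : bessel b) z :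
  a ^+ 2 * sqn z <= sqn (frame_op z).
Proof.
have [a0 Flb] := ha.
have [z0|z0] := eqVneq (sqn z) 0; first by rewrite z0 mulr0 sqn_ge0.
have zp : 0 < sqn z by rewrite lt0r z0 sqn_ge0.
rewrite -(ler_pM2r zp); apply: le_trans (hdot_CS (frame_op z) z).
rewrite -mulrA -expr2 -exprMn ler_pXn2r ?nnegrE ?(frame_op_ge ha hb) //.
  by rewrite mulr_ge0 ?ltW.
by apply: le_trans (frame_op_ge ha hb z); rewrite mulr_ge0 ?ltW.
Qed.

Lemma frame_op_inj (a b : R) (ha : frame_lower a) (hb : bessel b) : injective frame_op.
Proof.
have [a0 Flb] := ha.
move=> x y e; apply/eqP; rewrite -subr_eq0; apply/eqP/sqn_eq0.
have := frame_op_coercive ha hb (x - y).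
rewrite (lin_opB (selfadj_lin (frame_op_selfadj hb))) e subrr sqn0 => h.
apply/eqP; rewrite eq_le sqn_ge0 andbT.
by rewrite -(ler_pM2l (x := a ^+ 2)) ?exprn_gt0 // mulr0.
Qed.

(** Coercivity makes the range closed. The component of [y] orthogonal to the range is killed by the
    self-adjoint operator, so it is zero by injectivity. *)
Lemma frame_op_surj (a b : R) (ha : frame_lower a) (hb : bessel b) y : exists x, frame_op x = y.
Proof.
have [a0 Flb] := ha.
have lS := selfadj_lin (frame_op_selfadj hb); have bS := frame_op_bounded hb.
pose V : set X := range frame_op.
have cV : closed_subspace V.
  split; first by exists 0 => //; rewrite (lin_op0 lS).
  split=> [c x z [x' _ <-] [z' _ <-]|u x Vu ux]; first by exists (c *: x' + z').
  have /choice [u' hu'] : forall n, exists x', frame_op x' = u n.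
    by move=> n; have [x' _ h] := Vu n; exists x'.
  have [|x' hx'] := @cauchy_sqn_eps _ u'.
    move=> e e0; have e1 : 0 < a ^+ 2 * e / 4 by rewrite divr_gt0 // mulr_gt0 // exprn_gt0.
    have [N hN] := (hconvP _ _).1 ux _ e1; exists N => m n Nm Nn.
    rewrite -(ler_pM2l (x := a ^+ 2)) ?exprn_gt0 //.
    apply: le_trans (frame_op_coercive ha hb _) _; rewrite (lin_opB lS) !hu'.
    have := hN m Nm; have := hN n Nn; have := sqn_dist_trans (u m) x (u n).
    rewrite (sqnBC x (u n)); lra.
  exists x' => //; apply: (hconv_uniq (bounded_hconv bS hx')).
  by rewrite (_ : frame_op \o u' = u) //; apply/funext => n /=.
have [x _ hx] := hproj_in y cV; exists x; rewrite hx.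
apply/esym/eqP; rewrite -subr_eq0; apply/eqP/(frame_op_inj ha hb)/hdot_injl => w.
rewrite (lin_op0 lS) hdot0l (frame_op_selfadj hb); apply: hproj_orth => //; by exists w.
Qed.

Lemma opinv_frame_opP (a b : R) (ha : frame_lower a) (hb : bessel b) :
  cancel frame_op (opinv frame_op) /\ cancel (opinv frame_op) frame_op.
Proof.
apply: (@epsilon_spec _ _ (fun B : X -> X => cancel frame_op B /\ cancel B frame_op)).
have /choice [B hB] := frame_op_surj ha hb; exists B; split=> // x; exact/(frame_op_inj ha hb)/hB.
Qed.

Lemma opinv_frame_op_selfadj (a b : R) (ha : frame_lower a) (hb : bessel b) :
  selfadj (opinv frame_op).
Proof.
have [_ SK] := opinv_frame_opP ha hb.
by move=> x y; rewrite -{1}(SK y) -(frame_op_selfadj hb) SK.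
Qed.

Lemma sqn_opinv_frame_op_le (a b : R) (ha : frame_lower a) (hb : bessel b) z :
  sqn (opinv frame_op z) <= (a ^+ 2)^-1 * sqn z.
Proof.
have [a0 Flb] := ha.
have := frame_op_coercive ha hb (opinv frame_op z); have [_ ->] := opinv_frame_opP ha hb.
by rewrite [_^-1 * _]mulrC ler_pdivlMr ?exprn_gt0 // mulrC.
Qed.

Lemma bounded_opinv_frame_op (a b : R) (ha : frame_lower a) (hb : bessel b) :
  bounded_op (opinv frame_op).
Proof.
apply/bounded_opP; split; first exact/selfadj_lin/(opinv_frame_op_selfadj ha hb).
exists (a ^+ 2)^-1; first by rewrite invr_ge0 sqr_ge0.
exact: sqn_opinv_frame_op_le ha hb.
Qed.

End FrameOperator.

(** * Gram sums and tensor products of operators *)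
Section Tensor.
Variable R : realType.
Implicit Types X Y Z : hilbert R.

(** Extension by continuity from a dense subspace. A relation replaces a function because a tensor
    has many representations as a finite sum; linearity and the bound together force
    single-valuedness. *)
Lemma dense_relation_op X Y (D : X -> Y -> Prop) (M : R) : 0 <= M ->
  (forall (a : R[i]) x y x' y', D x y -> D x' y' -> D (a *: x + x') (a *: y + y')) ->
  (forall x y, D x y -> sqn y <= M * sqn x) ->
  (forall x (e : R), 0 < e -> exists x' y', D x' y' /\ sqn (x - x') < e) ->
  exists A : X -> Y, bounded_op A /\ forall x y, D x y -> A x = y.
Proof.
move=> M0 Dlin Dbd Ddense.
(* [E] is the closure of [D] in the product and will be the graph of the operator. *)
pose E x y := forall e : R, 0 < e ->
  exists x' y', [/\ D x' y', sqn (x - x') <= e & sqn (y - y') <= e].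
have ED x y : D x y -> E x y.
  by move=> d e e0; exists x, y; rewrite !subrr !sqn0 ltW.
have Ebd x y : E x y -> sqn y <= 4 * M * sqn x.
  move=> h; apply: (@le_approx _ _ _ (4 * M + 2)) => [|e e0]; first by rewrite addr_ge0 // mulr_ge0.
  have [x' [y' [d hx hy]]] := h e e0.
  have h1 := sqn_le_dist y y'; have h2 := sqn_le_dist x' x; rewrite (sqnBC x' x) in h2.
  have h3 := ler_wpM2l M0 h2; have h4 := ler_wpM2l M0 hx; have h5 := Dbd _ _ d.
  lra.
have Elin (a : R[i]) x y x' y' : E x y -> E x' y' -> E (a *: x + x') (a *: y + y').
  move=> h h' e e0; have a0 : 0 <= normsq a by rewrite addr_ge0 ?sqr_ge0.
  have a1 : 0 < 2 * normsq a + 2 by lra.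
  have [|x1 [y1 [d1 hx1 hy1]]] := h (e / (2 * normsq a + 2)); first by rewrite divr_gt0.
  have [|x2 [y2 [d2 hx2 hy2]]] := h' (e / (2 * normsq a + 2)); first by rewrite divr_gt0.
  have ee : e = (2 * normsq a + 2) * (e / (2 * normsq a + 2)) by rewrite mulrC divfK // gt_eqF.
  set d := e / _ in hx1 hx2 hy1 hy2 ee.
  exists (a *: x1 + x2), (a *: y1 + y2); split; first exact: Dlin.
    rewrite opprD addrACA -scalerBr.
    have := sqnD_le (a *: (x - x1)) (x' - x2); rewrite sqnZ -/(normsq a).
    by have := ler_wpM2l a0 hx1; clearbody d; lra.
  rewrite opprD addrACA -scalerBr.
  have := sqnD_le (a *: (y - y1)) (y' - y2); rewrite sqnZ -/(normsq a).
  by have := ler_wpM2l a0 hy1; clearbody d; lra.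
have Ezero y : E 0 y -> y = 0.
  move=> /Ebd; rewrite sqn0 mulr0 => h; apply/sqn_eq0/eqP.
  by rewrite eq_le h sqn_ge0.
have Euniq x y y' : E x y -> E x y' -> y = y'.
  move=> h h'; have := Elin (-1) x y x y' h h'; rewrite !scaleN1r addNr => /Ezero.
  by rewrite addrC => /eqP; rewrite subr_eq0 => /eqP.
have /choice [A hA] : forall x, exists y, E x y.
  move=> x; have /choice [f hf] : forall n : nat, exists p : X * Y,
      D p.1 p.2 /\ sqn (x - p.1) < n.+1%:R^-1.
    move=> n; have [|x' [y' h]] := Ddense x (n.+1%:R^-1); first by rewrite invr_gt0.
    by exists (x', y').
  have [|y hy] := @cauchy_sqn _ _ (fun n => (f n).2) (2 * M).
    move=> m n; have [dm hm] := hf m; have [dn hn] := hf n.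
    have := Dbd _ _ (Dlin (-1) _ _ _ _ dn dm); rewrite !scaleN1r ![- _ + _]addrC => h.
    have h1 := sqn_dist_trans (f m).1 x (f n).1; rewrite (sqnBC _ x) in h1.
    set i := m.+1%:R^-1 in hm *; set j := n.+1%:R^-1 in hn *.
    have h2 : sqn ((f m).1 - (f n).1) <= 2 * i + 2 * j by lra.
    have := ler_wpM2l M0 h2; lra.
  exists y => e e0; have [n1 h1] := (hconvP _ _).1 hy _ e0; have [n2 h2] := inv_nat_lt e0.
  set n := maxn n1 n2; have [dn hn] := hf n; exists (f n).1, (f n).2; split=> //.
    by apply/ltW/(lt_trans hn)/h2/leq_maxr.
  by rewrite sqnBC; apply/ltW/h1/leq_maxl.
exists A; split=> [|x y /ED h]; last exact: Euniq (hA x) h.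
apply/bounded_opP; split=> [a x y|].
  by apply: Euniq (hA _) _; apply: Elin.
by exists (4 * M) => [|x]; [rewrite mulr_ge0|apply: Ebd].
Qed.

Lemma orth_closed X (z : X) : closed_subspace [set u | hdot z u = 0].
Proof.
split; first by rewrite /= hdot0r.
split=> [a x y /= hx hy|u x /= hu ux]; first by rewrite hdotDr hdotZr hx hy mulr0 addr0.
apply: normsq_eq0; apply: (@le_approx _ _ _ (2 * sqn z)) => [|e e0].
  by rewrite mulr_ge0 ?sqn_ge0.
have [N hN] := (hconvP _ _).1 ux _ e0; have {}hN := hN N (leqnn N).
have := normsq_hdot z (x - u N); rewrite hdotBr hu subr0 sqnBC => h.
have := ler_wpM2l (sqn_ge0 z) (ltW hN); lra.
Qed.

Lemma pairwise_orth_coef X (J : eqType) (r : seq J) (v : J -> X) (c : J -> R[i]) :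
  pairwise (fun p q => hdot (v p) (v q) == 0) r ->
  forall q, q \in r -> hdot (\sum_(p <- r) c p *: v p) (v q) = c q * hdot (v q) (v q).
Proof.
elim: r => [//|p r IH] /= /andP[/allP hp hr] q.
rewrite big_cons hdotDl hdotZl inE => /orP[/eqP ->|qr].
  rewrite hdot_suml big_seq big1 ?addr0 // => q' q'r.
  by rewrite hdotZl hdot_sym (eqP (hp _ q'r)) rmorph0 mulr0.
by rewrite (eqP (hp _ qr)) mulr0 add0r IH.
Qed.

(** Test functionals for the algebraic tensor product: two lists of pairs represent the same tensor
    when all bilinear forms agree on them. *)
Definition bilinear_form X Y (b : X -> Y -> R[i]) :=
  (forall a x x' y, b (a *: x + x') y = a * b x y + b x' y) /\
  (forall a x y y', b x (a *: y + y') = a * b x y + b x y').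

(* Gram-Schmidt in the second slot: both sequences represent the same element
   of the algebraic tensor product. *)
Lemma orthogonalize X Y (s : seq (X * Y)) : exists r : seq (X * Y),
  pairwise (fun p q => hdot p.2 q.2 == 0) r /\
  forall b : X -> Y -> R[i], bilinear_form b ->
    \sum_(p <- s) b p.1 p.2 = \sum_(p <- r) b p.1 p.2.
Proof.
elim: s => [|[f g] s [r [orth hr]]]; first by exists [::].
pose c (q : X * Y) := hdot g q.2 / hdot q.2 q.2.
pose g' := g - \sum_(q <- r) c q *: q.2.
(* The part of [g] along the vectors [q.2] is moved into the first slots; the second slots of [r]
   stay as they are, so their orthogonality persists. *)
exists ((f, g') :: [seq (q.1 + c q *: f, q.2) | q <- r]); split.
  rewrite /= pairwise_map; apply/andP; split; last exact: orth.
  apply/allP => _ /mapP[q qr ->] /=.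
  rewrite hdotBl (pairwise_orth_coef (v := snd) c orth qr) /c.
  (* For [q.2 = 0] the coefficient [c q] is a division by zero, but every pairing with [q.2]
     vanishes then. *)
  have [q0|q0] := eqVneq (hdot q.2 q.2) 0; last by rewrite divfK ?subrr.
  by rewrite (hdot_def q0) !hdot0r mulr0 subrr.
move=> b [b1 b2]; have b10 y : b 0 y = 0.
  by have := b1 (-1) 0 0 y; rewrite scaler0 addr0 mulN1r addNr.
have b20 x : b x 0 = 0.
  by have := b2 (-1) x 0 0; rewrite scaler0 addr0 mulN1r addNr.
have b2s : b f (\sum_(q <- r) c q *: q.2) = \sum_(q <- r) c q * b f q.2.
  elim: (r) => [|q r' IH]; first by rewrite !big_nil b20.
  by rewrite !big_cons b2 IH.
rewrite !big_cons hr //= big_map /=.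
have -> : b f g' = b f g - \sum_(q <- r) c q * b f q.2.
  by rewrite -b2s /g' addrC -scaleN1r b2 mulN1r addrC.
rewrite -addrA; congr (_ + _); rewrite -sumrN -big_split /=.
by apply: eq_bigr => q _; rewrite addrC -[q.1 + _]addrC b1; ring.
Qed.

(** The squared norm of the tensor represented by [s], written without a tensor product space, so
    that [A] (x) 1 can be used although no model of its target is given. *)
Definition gram X Y (s : seq (X * Y)) : R[i] :=
  \sum_(p <- s) \sum_(q <- s) hdot p.1 q.1 * hdot p.2 q.2.

Lemma pairwise_diag_sum (J : eqType) (r : seq J) (phi : J -> J -> R[i]) :
  pairwise (fun p q => (phi p q == 0) && (phi q p == 0)) r ->
  \sum_(p <- r) \sum_(q <- r) phi p q = \sum_(p <- r) phi p p.
Proof.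
elim: r => [|p r IH] /=; first by rewrite !big_nil.
move=> /andP[/allP hp /IH {}IH]; rewrite !big_cons -addrA; congr (_ + _).
rewrite big_seq big1 ?add0r => [|q /hp /andP[/eqP //]].
rewrite -IH [in LHS]big_seq [in RHS]big_seq; apply: eq_bigr => q /hp /andP[_ /eqP h].
by rewrite big_cons h add0r.
Qed.

(** Once the second slots are orthogonal, [A] (x) 1 keeps the cross terms zero; the norms of the
    second slots are absorbed into the first. It is essential that [r] does not depend on [A]. *)
Lemma gram_mapl_diag X Y (s : seq (X * Y)) : exists r : seq X,
  forall (X' : hilbert R) (A : X -> X'), lin_op A ->
    gram [seq (A p.1, p.2) | p <- s] = (\sum_(x <- r) sqn (A x))%:C.
Proof.
have [r [orth hr]] := orthogonalize s.
exists [seq (hnorm p.2)%:C *: p.1 | p <- r] => X' A lA.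
pose phi (p q : X * Y) := hdot (A p.1) (A q.1) * hdot p.2 q.2.
have bil (q : X * Y) : bilinear_form (fun x y => hdot (A x) (A q.1) * hdot y q.2).
  split=> [a x x' y|a x y y']; first by rewrite lA hdotDl hdotZl; ring.
  by rewrite hdotDl hdotZl; ring.
have phiC p q : phi p q = conjc (phi q p).
  by rewrite /phi rmorphM /= -!hdot_sym.
(* [phi] is bilinear only in its first pair; the second index is exchanged afterwards by conjugate
   symmetry. *)
have step q : \sum_(p <- s) phi p q = \sum_(p <- r) phi p q.
  exact: (hr _ (bil q)).
have -> : gram [seq (A p.1, p.2) | p <- s] = \sum_(p <- r) \sum_(q <- r) phi p q.
  rewrite /gram big_map; under eq_bigr do rewrite big_map /=.
  rewrite exchange_big /=.
  under eq_bigr => q _ do rewrite [\sum_(_ <- s) _]step.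
  rewrite exchange_big /=; apply: eq_bigr => p _.
  have e (u : seq (X * Y)) : \sum_(q <- u) phi p q = conjc (\sum_(q <- u) phi q p).
    by rewrite rmorph_sum; apply: eq_bigr.
  by rewrite !e step.
rewrite pairwise_diag_sum; last first.
  apply: sub_pairwise orth => p q /eqP h.
  by rewrite [phi q p]phiC /phi h mulr0 rmorph0 eqxx.
rewrite big_map rmorph_sum /=; apply: eq_bigr => p _.
rewrite (lin_opZ lA) sqnZ /= expr0n addr0 hnorm_sqr /phi !hdotxx -rmorphM.
by rewrite mulrC.
Qed.

Lemma gram_swap X Y (s : seq (X * Y)) : gram [seq (p.2, p.1) | p <- s] = gram s.
Proof.
rewrite /gram big_map; apply: eq_bigr => p _; rewrite big_map.
by apply: eq_bigr => q _; rewrite mulrC.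
Qed.

Definition rgram X Y (s : seq (X * Y)) : R := Re (gram s).

Lemma rgram_mapl_diag X Y (s : seq (X * Y)) : exists r : seq X,
  rgram s = \sum_(x <- r) sqn x /\
  forall (X' : hilbert R) (A : X -> X'), lin_op A ->
    rgram [seq (A p.1, p.2) | p <- s] = \sum_(x <- r) sqn (A x).
Proof.
have [r hr] := gram_mapl_diag s; exists r; split=> [|X' A lA]; last by rewrite /rgram hr.
have := hr X id (fun _ _ _ => erefl); rewrite /rgram (_ : map _ s = s) => [->//|].
by rewrite -[RHS]map_id; apply: eq_map => -[].
Qed.

Lemma rgram_mapr_diag X Y (s : seq (X * Y)) : exists r : seq Y,
  rgram s = \sum_(y <- r) sqn y /\
  forall (Y' : hilbert R) (B : Y -> Y'), lin_op B ->
    rgram [seq (p.1, B p.2) | p <- s] = \sum_(y <- r) sqn (B y).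
Proof.
have [r [h0 hr]] := rgram_mapl_diag [seq (p.2, p.1) | p <- s]; exists r; split.
  by rewrite -h0 /rgram gram_swap.
move=> Y' B lB; rewrite -hr // /rgram -gram_swap -!map_comp.
by [].
Qed.

Lemma rgram_ge0 X Y (s : seq (X * Y)) : 0 <= rgram s.
Proof.
by have [r [-> _]] := rgram_mapl_diag s; apply: sumr_ge0 => x _; apply: sqn_ge0.
Qed.

(** Factor [A] (x) [B] as 1 (x) [B] after [A] (x) 1 and diagonalize for each factor. *)
Lemma rgram_map_le X Y X' Y' (A : X -> X') (B : Y -> Y') (M N : R) (s : seq (X * Y)) :
  lin_op A -> lin_op B -> 0 <= N ->
  (forall x, sqn (A x) <= M * sqn x) -> (forall y, sqn (B y) <= N * sqn y) ->
  rgram [seq (A p.1, B p.2) | p <- s] <= N * M * rgram s.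
Proof.
move=> lA lB N0 hA hB.
have [r [h0 /(_ _ A lA) hr]] := rgram_mapl_diag s.
have [r' [h0' /(_ _ B lB) hr']] := rgram_mapr_diag [seq (A p.1, p.2) | p <- s].
have -> : [seq (A p.1, B p.2) | p <- s] =
    [seq (p.1, B p.2) | p <- [seq (A p.1, p.2) | p <- s]] by rewrite -map_comp.
apply: (@le_trans _ _ (N * rgram [seq (A p.1, p.2) | p <- s])).
  by rewrite hr' h0' mulr_sumr; apply: ler_sum => y _.
rewrite -mulrA; apply: ler_wpM2l => //.
by rewrite hr h0 mulr_sumr; apply: ler_sum => y _.
Qed.

Variables (X Y Z : hilbert R) (t : X -> Y -> Z).
Hypothesis ht : is_tensor t.

Definition tsum (s : seq (X * Y)) : Z := \sum_(p <- s) t p.1 p.2.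

Lemma sqn_tsum s : sqn (tsum s) = rgram s.
Proof.
rewrite /sqn /rgram /gram /tsum hdot_suml; congr Re; apply: eq_bigr => p _.
by rewrite hdot_sumr; apply: eq_bigr => q _; case: ht => _ [_ [->]].
Qed.

Lemma tsum_dense z (e : R) : 0 < e -> exists s, sqn (z - tsum s) < e.
Proof.
move=> e0; have [_ [_ [_ d]]] := ht; have [|s hs] := d z (Num.sqrt e).
  by rewrite sqrtr_gt0.
by exists s; move: hs; rewrite ltr_sqrt.
Qed.

Lemma tsum_linear X' Y' Z' (t' : X' -> Y' -> Z') (Q : X -> X') (T : Y -> Y') a s s' :
  lin_op Q -> (forall g, lin_op (fun f => t' f g)) ->
  \sum_(p <- [seq (a *: p.1, p.2) | p <- s] ++ s') t' (Q p.1) (T p.2) =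
  a *: (\sum_(p <- s) t' (Q p.1) (T p.2)) + \sum_(p <- s') t' (Q p.1) (T p.2).
Proof.
move=> lQ lt'; rewrite big_cat big_map scaler_sumr; congr (_ + _).
by apply: eq_bigr => p _; rewrite /= (lin_opZ lQ) (lin_opZ (lt' _)).
Qed.

(** [tensop] is a choice, so an operator must be exhibited: the relation between finite tensor sums
    and their images is bounded by [rgram_map_le], and is extended by density. *)
Lemma tensopP (X' Y' Z' : hilbert R) (t' : X' -> Y' -> Z') (Q : X -> X') (T : Y -> Y') :
  is_tensor t' -> bounded_op Q -> bounded_op T ->
  bounded_op (tensop t t' Q T) /\
  forall f g, tensop t t' Q T (t f g) = t' (Q f) (T g).
Proof.
move=> ht' /bounded_opP[lQ [M M0 hM]] /bounded_opP[lT [N N0 hN]].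
apply: (@epsilon_spec _ _ (fun A : Z -> Z' =>
  bounded_op A /\ forall f g, A (t f g) = t' (Q f) (T g))).
have [_ [tl [_ _]]] := ht; have [_ [tl' [td' _]]] := ht'.
pose D z y := exists s, z = tsum s /\ y = \sum_(p <- s) t' (Q p.1) (T p.2).
have [||z y [s [-> ->]]|z e e0|A [bA hA]] := @dense_relation_op _ _ D (N * M).
- exact: mulr_ge0.
- move=> a z y z' y' [s [-> ->]] [s' [-> ->]].
  exists ([seq (a *: p.1, p.2) | p <- s] ++ s'); split.
    exact/esym/(@tsum_linear _ _ _ t id id a s s' (fun _ _ _ => erefl) tl).
  exact: esym (tsum_linear T a s s' lQ tl').
- rewrite sqn_tsum; apply: le_trans (rgram_map_le s lQ lT N0 hM hN).
  rewrite /sqn /rgram /gram hdot_suml big_map le_eqVlt; apply/orP; left; apply/eqP.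
  congr Re; apply: eq_bigr => p _; rewrite hdot_sumr big_map.
  by apply: eq_bigr => q _; rewrite td'.
- have [s hs] := tsum_dense z e0.
  by exists (tsum s), (\sum_(p <- s) t' (Q p.1) (T p.2)); split=> //; exists s.
exists A; split=> // f g; apply: hA; exists [:: (f, g)].
by rewrite /tsum !big_cons !big_nil !addr0.
Qed.

Lemma tens_sub_closed (V : set X) (W : set Y) : closed_subspace (tens_sub t V W).
Proof.
split=> [U cU _|]; first by case: cU.
split=> [a x y hx hy U cU hU|u x hu ux U cU hU].
  by have [_ [h _]] := cU; apply: h; [apply: hx|apply: hy].
by have [_ [_ h]] := cU; apply: h ux => n; apply: hu.
Qed.

(** The difference splits into one tensor whose first factor is orthogonal to [V] and one whose
    second factor is orthogonal to [W]. Orthogonality to the generators suffices, since an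
    orthogonal complement is closed. *)
Lemma hproj_tens (V : set X) (W : set Y) f g :
  closed_subspace V -> closed_subspace W ->
  hproj (tens_sub t V W) (t f g) = t (hproj V f) (hproj W g).
Proof.
move=> cV cW; have [tr [tl [td _]]] := ht.
apply: hproj_uniq => [||u hu]; first exact: tens_sub_closed.
  by move=> U cU; apply; apply: hproj_in.
apply: (hu _ (orth_closed _)) => v w Vv Ww /=.
have -> : t f g - t (hproj V f) (hproj W g) =
    t (f - hproj V f) g + t (hproj V f) (g - hproj W g).
  by rewrite (lin_opB (tl g)) (lin_opB (tr _)) addrA subrK.
by rewrite hdotDl !td (hproj_orth f cV Vv) (hproj_orth g cW Ww) mul0r mulr0 addr0.
Qed.

End Tensor.

(** * Frame inequalities on the tensor product *)
Section FrameBounds.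
Variable R : realType.
Implicit Types X Y Z : hilbert R.

(** Together with the three lemmas that follow, this translates between [esum], a supremum over
    finite sets, and real sums over duplicate-free lists. *)
Lemma esum_finsub (T : choiceType) (I : set T) (q : T -> R) (c : R) :
  (forall s, finsub I s -> \sum_(p <- s) q p <= c) ->
  (\esum_(p in I) (q p)%:E <= c%:E)%E.
Proof.
move=> h; apply: ge_ereal_sup => _ [A [finA AI] <-].
rewrite fsbig_finite //= sumEFin lee_fin; apply: h; split; first exact: finmap.fset_uniq.
by move=> p; rewrite in_fset_set // inE => /AI.
Qed.

Lemma finsub_le_esum (T : choiceType) (I : set T) (q : T -> R) s :
  finsub I s -> ((\sum_(p <- s) q p)%:E <= \esum_(p in I) (q p)%:E)%E.
Proof.
move=> [us sI]; apply: ereal_sup_ubound; exists [set` s].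
  by split=> [|p /= /sI]; first exact: finite_seq.
by rewrite -sumEFin -fsbig_seq.
Qed.

Lemma esum_lower_approx (T : choiceType) (I : set T) (q : T -> R) (c e : R) :
  (c%:E <= \esum_(p in I) (q p)%:E)%E -> 0 < e ->
  exists s, finsub I s /\ c <= \sum_(p <- s) q p + e.
Proof.
move=> h e0; have : ((c - e)%:E < \esum_(p in I) (q p)%:E)%E.
  by apply: lt_le_trans h; rewrite lte_fin ltrBlDr ltrDl.
move=> /ereal_sup_gt [_ [A [finA AI] <-]].
rewrite fsbig_finite //= sumEFin lte_fin => lt; exists (finmap.enum_fset (fset_set A)); split.
  split; first exact: finmap.fset_uniq.
  by move=> p; rewrite in_fset_set // inE => /AI.
by rewrite -lerBlDr ltW.
Qed.

Lemma esum_lower (T : choiceType) (I : set T) (q : T -> R) (c : R) :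
  (forall e, 0 < e -> exists s, finsub I s /\ c <= \sum_(p <- s) q p + e) ->
  (c%:E <= \esum_(p in I) (q p)%:E)%E.
Proof.
move=> h; apply/lee_addgt0Pr => e e0; have [s [fs hs]] := h e e0.
apply: (@le_trans _ _ ((\sum_(p <- s) q p)%:E + e%:E)%E); first by rewrite -EFinD lee_fin.
by apply: leeD => //; apply: finsub_le_esum.
Qed.

Definition frame_ineq X (T : choiceType) (I : set T) (Y : T -> hilbert R)
    (A : forall i, X -> Y i) (a b : R) := forall x,
  ((a * sqn x)%:E <= \esum_(i in I) (sqn (A i x))%:E <= (b * sqn x)%:E)%E.

Lemma frame_ineq_sum X (T : choiceType) (I : set T) (Y : T -> hilbert R)
    (A : forall i, X -> Y i) (a b k : R) (r : seq X) :
  (forall i, I i -> lin_op (A i)) -> frame_ineq I A a b -> 0 <= k ->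
  ((a * (k * \sum_(x <- r) sqn x))%:E <=
     \esum_(i in I) (k * \sum_(x <- r) sqn (A i x))%:E <=
   (b * (k * \sum_(x <- r) sqn x))%:E)%E.
Proof.
move=> lA h k0; pose r' := [seq (Num.sqrt k)%:C *: x | x <- r].
have e (W : hilbert R) (B : X -> W) : lin_op B ->
    k * \sum_(x <- r) sqn (B x) = \sum_(x <- r') sqn (B x).
  move=> lB; rewrite big_map mulr_sumr; apply: eq_bigr => x _.
  by rewrite (lin_opZ lB) sqnZ /= expr0n addr0 sqr_sqrtr.
rewrite (e X id) // (@eq_esum _ _ _ _ (fun i => (\sum_(x <- r') (sqn (A i x))%:E)%E)); last first.
  by move=> i Ii; rewrite (e _ _ (lA i Ii)) sumEFin.
rewrite esum_sum; last by move=> i x _ _; rewrite lee_fin sqn_ge0.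
rewrite !mulr_sumr -!sumEFin.
by apply/andP; split; apply: lee_sum => x _; have /andP[] := h x.
Qed.

(** For fixed [i], the inequality for [B] controls the sum over [j] by the Gram sum after [A i] (x)
    1. This equals a sum over a list [r] common to all [i], so the inequality for [A] then controls
    the sum over [i]. *)
Lemma frame_ineq_rgram X Y (T U : choiceType) (I : set T) (J : set U)
    (X' : T -> hilbert R) (Y' : U -> hilbert R)
    (A : forall i, X -> X' i) (B : forall j, Y -> Y' j) (a b c d : R) s :
  (forall i, I i -> lin_op (A i)) -> (forall j, J j -> lin_op (B j)) ->
  frame_ineq I A a b -> frame_ineq J B c d -> 0 <= c -> 0 <= d ->
  ((a * c * rgram s)%:E <=
     \esum_(p in I `*` J) (rgram [seq (A p.1 q.1, B p.2 q.2) | q <- s])%:E <=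
   (b * d * rgram s)%:E)%E.
Proof.
move=> lA lB hA hB c0 d0.
have [r [h0 hr]] := rgram_mapl_diag s.
have inner i : I i -> ((c * \sum_(x <- r) sqn (A i x))%:E <=
    \esum_(j in J) (rgram [seq (A i q.1, B j q.2) | q <- s])%:E <=
    (d * \sum_(x <- r) sqn (A i x))%:E)%E.
  move=> Ii; rewrite -(hr _ _ (lA i Ii)).
  have [r' [h0' hr']] := rgram_mapr_diag [seq (A i q.1, q.2) | q <- s].
  have := frame_ineq_sum r' lB hB (@ler01 R); rewrite !mul1r -h0'.
  rewrite (@eq_esum _ _ _ _ (fun j => (rgram [seq (A i q.1, B j q.2) | q <- s])%:E)) //.
  by move=> j Jj; rewrite mul1r -(hr' _ _ (lB j Jj)) -map_comp.
have -> : \esum_(p in I `*` J) (rgram [seq (A p.1 q.1, B p.2 q.2) | q <- s])%:E =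
    \esum_(i in I) \esum_(j in J) (rgram [seq (A i q.1, B j q.2) | q <- s])%:E.
  by rewrite esum_esum // => i j _ _; rewrite lee_fin rgram_ge0.
have /andP[lo _] := frame_ineq_sum r lA hA c0.
have /andP[_ up] := frame_ineq_sum r lA hA d0.
rewrite h0 -!mulrA; apply/andP; split.
  by apply: le_trans lo _; apply: le_esum => i /inner /andP[].
by apply: le_trans up; apply: le_esum => i /inner /andP[].
Qed.

Lemma frame_ineq_dense Z (T : choiceType) (I : set T) (Y : T -> hilbert R)
    (Q : forall p, Z -> Y p) (D : set Z) (a b : R) :
  (forall p, I p -> bounded_op (Q p)) ->
  (forall z (e : R), 0 < e -> exists2 z', D z' & sqn (z - z') < e) ->
  0 < a -> 0 <= b ->
  (forall z, D z -> ((a * sqn z)%:E <= \esum_(p in I) (sqn (Q p z))%:E <= (b * sqn z)%:E)%E) ->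
  frame_ineq I Q (a / 4) (4 * b).
Proof.
move=> bQ dense a0 b0 h.
have /choice [M hM] : forall p, exists M : R, I p -> 0 <= M /\ forall z, sqn (Q p z) <= M * sqn z.
  move=> p; case: (pselect (I p)) => [/bQ /bounded_opP [_ [M M0 hM]]|nI]; last by exists 0.
  by exists M.
have hsum s z z' : finsub I s -> \sum_(p <- s) sqn (Q p z) <=
    2 * (\sum_(p <- s) sqn (Q p z')) + 2 * \sum_(p <- s) sqn (Q p (z - z')).
  move=> [_ fs]; rewrite !mulr_sumr -big_split /=.
  rewrite big_seq [leRHS]big_seq; apply: ler_sum => p /fs /bQ [lQ _].
  by rewrite (lin_opB lQ); apply: sqn_le_dist.
have ubD s z : finsub I s -> D z -> \sum_(p <- s) sqn (Q p z) <= b * sqn z.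
  move=> fs /h /andP[_ hz]; rewrite -lee_fin; apply: le_trans hz.
  exact: finsub_le_esum.
have ub s z : finsub I s -> \sum_(p <- s) sqn (Q p z) <= 4 * b * sqn z.
  move=> fs; have C0 : 0 <= \sum_(p <- s) M p.
    by rewrite big_seq; apply: sumr_ge0 => p /fs.2 /hM [].
  apply: (@le_approx _ _ _ (4 * b + 2 * \sum_(p <- s) M p)) => [|e e0].
    by rewrite addr_ge0 // mulr_ge0.
  have [z' Dz' hz'] := dense z e e0.
  have h1 := hsum s z z' fs; have h2 := ubD s z' fs Dz'.
  have h3 : \sum_(p <- s) sqn (Q p (z - z')) <= (\sum_(p <- s) M p) * e.
    rewrite mulr_suml big_seq [leRHS]big_seq; apply: ler_sum => p /fs.2 /hM [M0 hp].
    by apply: le_trans (hp _) _; apply: ler_wpM2l => //; apply: ltW.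
  have := ler_wpM2l b0 (sqn_le_dist z' z); rewrite (sqnBC z' z).
  have := ler_wpM2l b0 (ltW hz'); lra.
move=> z; apply/andP; split; last by apply: esum_finsub => s; apply: ub.
apply: esum_lower => e0' e0'0.
(* Now [s] depends on [z'], so the error at [z' - z] is controlled by [ub], which is uniform in [s].
   The denominator collects the error terms with [b], 1 and [a]. *)
have k0 : 0 < 4 * b + 1 + a by lra.
pose e := e0' / (4 * b + 1 + a); have e0 : 0 < e by rewrite divr_gt0.
have ee : e0' = (4 * b + 1 + a) * e by rewrite mulrC divfK // gt_eqF.
clearbody e; have [z' Dz' hz'] := dense z e e0; have /andP[/esum_lower_approx lo _] := h z' Dz'.
have [s [fs hs]] := lo e e0; exists s; split=> //.
have h1 := hsum s z' z fs; have h2 := ub s (z' - z) fs; rewrite (sqnBC z' z) in h2.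
have h3 := ler_wpM2l b0 (ltW hz').
have := ler_wpM2l (ltW a0) (sqn_le_dist z z'); have := ler_wpM2l (ltW a0) (ltW hz').
have : 0 < a * e by rewrite mulr_gt0.
lra.
Qed.

Lemma bounded_opZ X Y (c : R[i]) (A : X -> Y) : bounded_op A -> bounded_op (fun x => c *: A x).
Proof.
move=> /bounded_opP[lA [M M0 hM]]; apply/bounded_opP; split=> [a x y|].
  by rewrite lA scalerDr !scalerA mulrC.
exists (normsq c * M) => [|x]; first by rewrite mulr_ge0 // addr_ge0 ?sqr_ge0.
by rewrite sqnZ -mulrA; apply: ler_wpM2l; rewrite ?addr_ge0 ?sqr_ge0.
Qed.

(** The image under [B] is the preimage of [V] under its bounded inverse [S], so it inherits
    closedness. *)
Lemma image_closed X (S B : X -> X) (V : set X) :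
  bounded_op S -> lin_op B -> cancel S B -> cancel B S ->
  closed_subspace V -> closed_subspace (B @` V).
Proof.
move=> bS lB SK BK [V0 [Vlin Vcl]]; split; first by exists 0 => //; apply: lin_op0.
split=> [a x y [x' Vx <-] [y' Vy <-]|u x Vu ux].
  by exists (a *: x' + y'); [apply: Vlin|rewrite lB].
exists (S x); last exact: SK.
apply: (Vcl _ _ _ (bounded_hconv bS ux)) => n /=.
by have [x' Vx' <-] := Vu n; rewrite BK.
Qed.

(** This removes the inner projection from the dual family: by self-adjointness [B] maps the
    complement of the image of [V] into the complement of [V]. *)
Lemma hproj_image X (B : X -> X) (V : set X) z :
  selfadj B -> closed_subspace V -> closed_subspace (B @` V) ->
  hproj V (B (hproj (B @` V) z)) = hproj V (B z).
Proof.
move=> sB cV cU; apply/esym/eqP; rewrite -subr_eq0.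
rewrite -(lin_opB (selfadj_lin (hproj_selfadj cV))) -(lin_opB (selfadj_lin sB)).
apply/eqP/hproj_uniq => // [|v Vv]; first by case: cV.
by rewrite subr0 sB; apply: hproj_orth => //; exists v.
Qed.

Lemma frame_ineq_family X (T : choiceType) (I : set T) (Y : T -> hilbert R)
    (Q : forall p, X -> Y p) (F : T -> X -> X) (a b : R) :
  0 < a -> 0 <= b ->
  (forall p, I p -> forall x y, hdot (F p x) y = hdot (Q p x) (Q p y)) ->
  frame_ineq I Q a b ->
  [/\ forall p, I p -> selfadj (F p),
      forall p, I p -> forall z, 0 <= Re (hdot (F p z) z),
      bessel I F b & frame_lower I F a].
Proof.
move=> a0 b0 hF h.
have e s z : finsub I s ->
    \sum_(p <- s) Re (hdot (F p z) z) = \sum_(p <- s) sqn (Q p z).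
  by move=> [_ fs]; apply: eq_big_seq => p /fs Ip; rewrite hF.
split=> [p Ip x y|p Ip z||].
- by rewrite hF // [LHS]hdot_sym -hF // -hdot_sym.
- by rewrite hF //; apply: sqn_ge0.
- split=> // s fs z; rewrite e // -lee_fin.
  by have /andP[_] := h z; apply: le_trans; apply: finsub_le_esum.
- split=> // z d d0; have /andP[lo _] := h z.
  by have [s [fs hs]] := esum_lower_approx lo d0; exists s; rewrite e.
Qed.

End FrameBounds.

(** * The dual family *)
Section Dual.
Variable R : realType.
Implicit Types X Y Z : hilbert R.

Lemma gfusion_frame_ineq X (Y : int -> hilbert R) (I : set int) (V : int -> set X)
    (L : forall i, X -> Y i) (v : int -> R) : gfusion_frame I V L v ->
  exists a b : R, [/\ 0 < a, 0 <= b &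
    frame_ineq I (fun i x => (v i)%:C *: L i (hproj (V i) x)) a b].
Proof.
move=> [_ [a [b [a0 ab h]]]]; exists a, b; split=> //; first by rewrite (le_trans _ ab) // ltW.
move=> x; have := h x; rewrite hnorm_sqr.
rewrite (@eq_esum _ _ _ _ (fun i => (sqn ((v i)%:C *: L i (hproj (V i) x)))%:E)) // => i _.
by rewrite sqnZ /= expr0n addr0 hnorm_sqr.
Qed.

Lemma frame_dual_bounds X (T : choiceType) (I : set T) (Y : T -> hilbert R)
    (Q : forall p, X -> Y p) (S : X -> X) (a b M N : R) :
  frame_ineq I Q a b -> 0 < a -> 0 <= b -> 0 <= M -> 0 <= N ->
  (forall z, sqn z <= M * sqn (S z)) -> (forall z, sqn (S z) <= N * sqn z) ->
  exists A B : R, [/\ 0 < A, A <= B & frame_ineq I (fun p z => Q p (S z)) A B].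
Proof.
move=> h a0 b0 M0 N0 hM hN; have M1 : 0 < M + 1 by lra.
have A0 : 0 < a / (M + 1) by rewrite divr_gt0.
(* [M + 1] guards against division by zero, and the extra summand in the upper constant guarantees
   that it is at least the lower one. *)
exists (a / (M + 1)), (b * N + a / (M + 1)); split=> [//||z].
  by rewrite lerDr mulr_ge0.
have /andP[lo up] := h (S z); apply/andP; split.
  apply: le_trans lo; rewrite lee_fin mulrAC ler_pdivrMr // -mulrA ler_pM2l //.
  by apply: (le_trans (hM z)); rewrite mulrC ler_wpM2l ?sqn_ge0 // lerDl.
apply: (le_trans up); rewrite lee_fin.
have := ler_wpM2l b0 (hN z); have := mulr_ge0 (ltW A0) (sqn_ge0 z); lra.
Qed.

End Dual.

Theorem theorem3p7 (R : realType) (H K HK : hilbert R)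
  (Hi Kj : int -> hilbert R) (HKij : int -> int -> hilbert R)
  (t : H -> K -> HK) (tij : forall i j, Hi i -> Kj j -> HKij i j)
  (I J : set int) (V : int -> set H) (W : int -> set K)
  (L : forall i, H -> Hi i) (G : forall j, K -> Kj j) (v w : int -> R) :
  separable H -> separable K ->
  is_tensor t -> (forall i j, is_tensor (tij i j)) ->
  gfusion_frame I V L v -> gfusion_frame J W G w ->
  let S := frame_op_tens t tij I J V W L G v w in
  gfusion_frame_tens (Yij := HKij) t I J
    (fun i j => opinv S @` tens_sub t (V i) (W j))
    (fun i j => fun z => tensop t (tij i j) (L i) (G j)
                           (hproj (tens_sub t (V i) (W j)) (opinv S z)))
    (fun i j => v i * w j).
Proof.
move=> _ _ ht htij hL hG S.
have [a [b [a0 b0 bndL]]] := gfusion_frame_ineq hL.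
have [c [d [c0 d0 bndG]]] := gfusion_frame_ineq hG.
have [fL _] := hL; have [fG _] := hG.
pose U (p : int * int) := tens_sub t (V p.1) (W p.2).
have cU p : closed_subspace (U p) by apply: tens_sub_closed.
pose LG (p : int * int) := tensop t (tij p.1 p.2) (L p.1) (G p.2).
pose Q (p : int * int) z : HKij p.1 p.2 := (v p.1 * w p.2)%:C *: LG p (hproj (U p) z).
(* Exactly the summand of [frame_op_tens], so [S] is by conversion the [frame_op] of this family. *)
pose F (p : int * int) z : HK :=
  ((v p.1 * w p.2) ^+ 2)%:C *: hproj (U p) (hadj (LG p) (LG p (hproj (U p) z))).
have hLG p : (I `*` J) p -> bounded_op (LG p) /\
    forall f g, LG p (t f g) = tij p.1 p.2 (L p.1 f) (G p.2 g).
  by move=> [/fL [_ bL _] /fG [_ bG _]]; apply: tensopP.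
have bQ p : (I `*` J) p -> bounded_op (Q p).
  move=> /hLG [bLG _]; apply: bounded_opZ; apply: (bounded_op_comp bLG).
  exact: bounded_hproj.
have hF p : (I `*` J) p -> forall x y, hdot (F p x) y = hdot (Q p x) (Q p y).
  move=> /hLG [bLG _] x y; rewrite /F /Q !hdotZl hdotZr conjc_real mulrA -rmorphM -expr2.
  by rewrite hproj_selfadj // hdot_sym -(hadjP bLG) -hdot_sym.
have frameQ : frame_ineq (I `*` J) Q (a * c / 4) (4 * (b * d)).
  apply: (@frame_ineq_dense _ _ _ _ _ _ (range (tsum t))) => // [z e e0|||_ [s _ <-]].
  - by have [s hs] := tsum_dense ht z e0; exists (tsum t s); first by exists s.
  - exact: mulr_gt0.
  - exact: mulr_ge0.
  rewrite (sqn_tsum ht).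
  (* On finite tensor sums [Q] acts as the tensor product of the two weighted families [v i] [L i]
     [hproj (V i)] and [w j] [G j] [hproj (W j)]. *)
  have := @frame_ineq_rgram _ _ _ _ _ _ _ _ _ _ _ _ _ _ _ s _ _ bndL bndG (ltW c0) d0.
  rewrite (@eq_esum _ _ _ (fun p => (rgram _)%:E) (fun p => (sqn (Q p (tsum t s)))%:E)).
    apply.
    - move=> i /fL [cV [lL _] _] k x y.
      by rewrite (selfadj_lin (hproj_selfadj cV)) lL scalerDr !scalerA mulrC.
    - move=> j /fG [cW [lG _] _] k x y.
      by rewrite (selfadj_lin (hproj_selfadj cW)) lG scalerDr !scalerA mulrC.
  move=> p Ip; have [[lLG _] eLG] := hLG p Ip.
  have [/fL [cV _ _] /fG [cW _ _]] := Ip.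
  congr EFin; have [tr [tl _]] := htij p.1 p.2.
  rewrite -(sqn_tsum (htij p.1 p.2)) /Q /tsum big_map.
  rewrite (lin_op_sum (selfadj_lin (hproj_selfadj (cU p)))) (lin_op_sum lLG) scaler_sumr.
  congr sqn; apply: eq_bigr => q _ /=.
  rewrite (hproj_tens ht _ _ cV cW) eLG (lin_opZ (tl _)) (lin_opZ (tr _)).
  by rewrite scalerA rmorphM.
have ac0 : 0 < a * c / 4 by rewrite divr_gt0 // mulr_gt0.
have bd0 : 0 <= 4 * (b * d) by rewrite !mulr_ge0.
have [Fsa Fpsd Fb Fl] := frame_ineq_family ac0 bd0 hF frameQ.
have [SK BK] : cancel S (opinv S) /\ cancel (opinv S) S := opinv_frame_opP Fsa Fpsd Fl Fb.
have bS : bounded_op S := frame_op_bounded Fsa Fpsd Fb.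
have sB : selfadj (opinv S) := opinv_frame_op_selfadj Fsa Fpsd Fl Fb.
have bB : bounded_op (opinv S) := bounded_opinv_frame_op Fsa Fpsd Fl Fb.
have cBU p : closed_subspace (opinv S @` U p).
  exact: (image_closed bS (selfadj_lin sB) SK BK).
split=> [i j Ii Jj|].
  have Ip : (I `*` J) (i, j) by [].
  have [bLG _] := hLG _ Ip; have [_ _ v0] := fL i Ii; have [_ _ w0] := fG j Jj.
  split; [exact: (cBU (i, j))| |exact: mulr_gt0].
  apply: (bounded_op_comp bLG); apply: (bounded_op_comp _ bB).
  exact: (bounded_hproj (cU (i, j))).
(* The bound [M] of [S], applied to [opinv S z], gives the lower estimate for [opinv S]; its own
   bound [N] gives the upper one. *)
have [_ [M M0 hM]] := (bounded_opP _).1 bS; have [_ [N N0 hN]] := (bounded_opP _).1 bB.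
have [|A [B [A0 AB hAB]]] := frame_dual_bounds frameQ ac0 bd0 M0 N0 _ hN.
  by move=> z; rewrite -{1}(BK z).
exists A, B; split=> // f g; have := hAB (t f g).
rewrite hnorm_sqr.
rewrite (@eq_esum _ _ _ (fun p => (sqn _)%:E) (fun p => (((v p.1 * w p.2) ^+ 2 *
  hnorm (LG p (hproj (U p) (opinv S (hproj (opinv S @` U p) (t f g))))) ^+ 2)%:E))) //.
move=> p _; rewrite (hproj_image _ sB (cU p) (cBU p)) /Q sqnZ /= expr0n addr0.
by rewrite hnorm_sqr.
Qed.
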